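(* Let $B$ be a regularized finite Blaschke product with distinct critical points and $n$ distinct critical values, and suppose $B=B_n\circ B_{n-1}\circ\cdots\circ B_1$ where each $B_j$ is a regularized Blaschke product of degree $2$ with $B_j(0)=0$ for $j=1,\dots,n$. Then the monodromy group associated with $B$ is (isomorphic to) the iterated wreath product of $n$ cyclic groups of order $2$, $\mathbb{Z}_2\wr\mathbb{Z}_2\wr\cdots\wr\mathbb{Z}_2$ ($n$ factors).
   Context: A finite Blaschke product of degree $d$ is $B(z)=\gamma\prod_{j=1}^d \frac{z-a_j}{1-\overline{a_j}z}$ with $a_j\in\mathbb{D}$ and $|\gamma|=1$. It is called regularized if $B(0)=0$, all zeros of $B$ are simple, and whenever $z_1,z_2$ are critical points of $B$ in $\mathbb{D}$ with $B(z_1)/B(z_2)>0$, then $B(z_1)=B(z_2)$. Let $S$ be the set of critical points of $B$ in $\mathbb{D}$ and $B(S)$ the set of critical values. Since $0\notin B(S)$, $B^{-1}$ has $N=\deg B$ distinct local branches $g_1,\dots,g_N$ near $0$. The monodromy group of $B$ is the group of permutations of $\{g_1,\dots,g_N\}$ induced by analytic continuation along closed loops in $\mathbb{D}\setminus B(S)$ based at $0$. *)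

(* Defs.v *)
From mathcomp Require Import all_boot all_order all_algebra all_fingroup.
From mathcomp Require Import all_classical all_reals all_analysis.
From mathcomp Require Import complex Rstruct Rstruct_topology.

Set Implicit Arguments.
Unset Strict Implicit.
Unset Printing Implicit Defensive.

Import Order.TTheory GRing.Theory Num.Theory.
Import numFieldNormedType.Exports.
Local Open Scope ring_scope.


Notation C := (Rdefinitions.R[i]).

Definition cderiv (f : C -> C) : C -> C := derive1 (f : C -> (C)^o).

Definition in_disc (z : C) : bool := `|z| < 1.

Definition blaschke_factor (a z : C) : C := (z - a) / (1 - a^* * z).

Definition is_blaschke (d : nat) (B : C -> C) : Prop :=
  exists (gamma : C) (a : seq C),
    [/\ `|gamma| = 1, size a = d, all in_disc a &
        forall z, in_disc z -> B z = gamma * \prod_(x <- a) blaschke_factor x z].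

Definition is_crit (B : C -> C) (z : C) : Prop := in_disc z /\ cderiv B z = 0.
Definition is_critval (B : C -> C) (w : C) : Prop :=
  exists z, is_crit B z /\ B z = w.

(* Regularized: B(0) = 0, zeros simple, and critical values with positive
   ratio coincide (0 < w in C means w is a positive real). *)
Definition regularized (B : C -> C) : Prop :=
  [/\ B 0 = 0,
      (forall z, in_disc z -> B z = 0 -> cderiv B z != 0) &
      (forall z1 z2, is_crit B z1 -> is_crit B z2 ->
         0 < B z1 / B z2 -> B z1 = B z2)].

(* "Distinct critical points": every critical point in D is simple. *)
Definition simple_critical_points (B : C -> C) : Prop :=
  forall z, is_crit B z -> cderiv (cderiv B) z != 0.

Definition num_critical_values (B : C -> C) (n : nat) : Prop :=
  exists v : seq C, [/\ uniq v, size v = n & forall w, is_critval B w <-> w \in v].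

(* z enumerates (without repetition) the fibre B^{-1}(0) in D, i.e. the
   values g_i(0) of the N local branches of B^{-1} near 0. *)
Definition fibre_enum (B : C -> C) (z : seq C) : Prop :=
  uniq z /\ forall w, (in_disc w /\ B w = 0) <-> w \in z.

Definition is_path (g : Rdefinitions.R -> C) : Prop :=
  ({within `[0, 1], continuous (g : Rdefinitions.R -> (C)^o)})%classic.

(* s is induced by continuation along a loop at 0 in D \ B(S): the lift of the
   loop starting at z_i (= continuation of the branch g_i) ends at z_(s i). *)
Definition monodromy_perm (B : C -> C) (z : seq C) (s : {perm 'I_(size z)}) : Prop :=
  exists g : Rdefinitions.R -> C,
    [/\ is_path g, g 0 = 0, g 1 = 0,
        (forall t, 0 <= t <= 1 -> in_disc (g t) /\ ~ is_critval B (g t)) &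
        (forall i : 'I_(size z), exists h : Rdefinitions.R -> C,
           [/\ is_path h,
               (forall t, 0 <= t <= 1 -> in_disc (h t) /\ B (h t) = g t),
               h 0 = nth 0 z i & h 1 = nth 0 z (s i)])].

Arguments monodromy_perm : clear implicits.

Definition monodromy_group (B : C -> C) (z : seq C) : {set {perm 'I_(size z)}} :=
  [set s : {perm 'I_(size z)} | `[< monodromy_perm B z s >]].

(* Iterated wreath product Z2 wr (Z2 wr (... wr Z2)) with n factors, as a
   permutation group on n-bit strings: W_0 = 1, and W_(m+1) = Z2 wr W_m, the
   permutational wreath product Z2^(X_m) x| W_m acting on bool * X_m by
   (b, t) |-> (b xor f t, h t), f : X_m -> Z2, h in W_m. *)
Fixpoint wreathZ2 (n : nat) : {set {perm n.-tuple bool}} :=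
  match n return {set {perm n.-tuple bool}} with
  | 0 => [set 1%g]
  | m.+1 => [set s : {perm m.+1.-tuple bool} |
      [exists f : {ffun m.-tuple bool -> bool},
        [exists h in wreathZ2 m,
          [forall b : bool, [forall t : m.-tuple bool,
             s (cons_tuple b t) == cons_tuple (b (+) f t) (h t)]]]]]
  end.

(* Main.v *)
(* Conjugating by disc automorphisms turns each factor [B_j] into [z ^+ 2], so
   paths lift through it by lifting square roots of paths.  The critical values
   of [B = B_n o ... o B_1] are the images of the [n] critical values of the
   factors, and since [B] has [n] critical values, these images are distinct.
   Now peel off [B_1] and write [B = F o B_1].  Every monodromy permutation
   of [B] covers one of [F] and so lies in the wreath product.  Conversely,
   every monodromy permutation of [F] lifts, and it remains to obtain the
   swap of a single pair of points of the fibre of [B] over [0]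
   with the same [B_1]-value.  Take the [B]-image of a path that goes from one of
   the two points to the vicinity of the critical point of [B_1], makes a half
   turn around it and comes back: all the other lifts of its turning part are closed,
   because the critical value of [B] so encircled comes from [B_1] only. *)
Require Import Defs.
From mathcomp Require Import all_boot all_order all_algebra all_fingroup.
From mathcomp Require Import all_classical all_reals all_analysis.
From mathcomp Require Import complex Rstruct Rstruct_topology.
From mathcomp Require Import ring lra.
Import Order.TTheory GRing.Theory Num.Theory.
Local Open Scope complex_scope.
Local Open Scope ring_scope.
Local Notation R := Rdefinitions.R.
Local Notation Re := complex.Re.
Local Notation Im := complex.Im.

Set Implicit Arguments.
Unset Strict Implicit.
(** * Complex norm and continuity *)

(** No covering theory is invoked: all that a two-sheeted factor must supply is packed into
    [square_cover]. Besides the coordinates, which give lifting, uniqueness of lifts and local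
    injectivity, it has two analytic clauses. The continuous slope [q] stands for the derivative;
    slopes multiply under composition, which places every critical value of [B] in [vals]. The bound
    [|x - y| ^ 2 <= 2 |B x - w|] is a quantitative properness: iterated along the tower, it keeps
    the lifts of a small loop close to the fibre over its centre, hence close to a single point of
    that fibre.

    The induction must only use loops that are admissible for the whole tower. A fixed set [V], in
    the end the set of critical values of [B], is therefore avoided at every level, although [vals]
    of an outer composite contains only part of it; each loop used for [F] then lifts through [B_1]
    as well. Fibres are labelled by bit strings throughout, and the enumeration [z] enters only at
    the end.

    The norm of [C] takes its values in [C]; the real-valued [cnorm] makes estimates accessible to
    linear arithmetic over the reals. *)

Definition cnorm (z : C) : R := ComplexField.Normc.normc z.

Lemma normCE (z : C) : `|z| = (cnorm z)%:C.
Proof. by []. Qed.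

Lemma cnorm_ge0 z : 0 <= cnorm z.
Proof. by rewrite -ler0c -normCE. Qed.

Lemma cnormM x y : cnorm (x * y) = cnorm x * cnorm y.
Proof. exact: ComplexField.Normc.normcM. Qed.

Lemma cnormN x : cnorm (- x) = cnorm x.
Proof. by apply: complexI; rewrite -!normCE normrN. Qed.

Lemma cnormB x y : cnorm (x - y) = cnorm (y - x).
Proof. by rewrite -cnormN opprB. Qed.

Lemma cnormD x y : cnorm (x + y) <= cnorm x + cnorm y.
Proof. by rewrite -lecR rmorphD -!normCE ler_normD. Qed.

Lemma cnorm0 : cnorm 0 = 0.
Proof. exact: ComplexField.Normc.normc0. Qed.

Lemma cnorm1 : cnorm 1 = 1.
Proof. exact: ComplexField.Normc.normc1. Qed.

Lemma cnormV x : cnorm x^-1 = (cnorm x)^-1.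
Proof. exact: ComplexField.Normc.normcV. Qed.

Lemma cnorm_gt0 x : (0 < cnorm x) = (x != 0).
Proof. by rewrite -ltcR -normCE normr_gt0. Qed.

Lemma in_discE z : in_disc z = (cnorm z < 1).
Proof. by rewrite /in_disc normCE -(ltcR _ 1). Qed.

Lemma cnorm_Re z : `|Re z| <= cnorm z.
Proof. by rewrite -lecR -normCE normc_ge_Re. Qed.

Lemma cnorm_dist x y z : cnorm (x - z) <= cnorm (x - y) + cnorm (y - z).
Proof. by apply: le_trans (cnormD _ _); rewrite addrA subrK. Qed.

Definition path_cont (g : R -> C) (t : R) : Prop :=
  {for t, continuous (g : R -> (C)^o)}%classic.
Definition ccont (f : C -> C) (z : C) : Prop :=
  {for z, continuous (f : (C)^o -> (C)^o)}%classic.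

Lemma path_contP g t : path_cont g t <->
  forall e : R, 0 < e -> exists2 d : R, 0 < d &
    forall s, `|s - t| < d -> cnorm (g s - g t) < e.
Proof.
rewrite /path_cont /continuous_at; split.
- move=> /cvgrPdist_lt cg e e0.
  have e0' : 0 < e%:C by rewrite ltcR.
  have /nbhs_ballP [d /= d0 dP] := cg _ e0'.
  exists d => // s sd.
  have := dP s; rewrite /ball /= distrC => /(_ sd).
  by rewrite distrC normCE ltcR.
- move=> H; apply/cvgrPdist_lt => e e0.
  have eR : e = (Re e)%:C by rewrite RRe_real // gtr0_real.
  have [|d d0 dP] := H (Re e); first by rewrite -ltcR -eR.
  apply/nbhs_ballP; exists d => //= s; rewrite /ball /= distrC => /dP.
  by rewrite -ltcR -eR -normCE distrC.
Qed.

Lemma ccontP f z : ccont f z <->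
  forall e : R, 0 < e -> exists2 d : R, 0 < d &
    forall s, cnorm (s - z) < d -> cnorm (f s - f z) < e.
Proof.
rewrite /ccont /continuous_at; split.
- move=> /cvgrPdist_lt cg e e0.
  have e0' : 0 < e%:C by rewrite ltcR.
  have /nbhs_ballP [d /= d0 dP] := cg _ e0'.
  have dR : d = (Re d)%:C by rewrite RRe_real // gtr0_real.
  exists (Re d); first by rewrite -ltcR -dR.
  move=> s sd.
  have := dP s; rewrite /ball /= distrC normCE dR ltcR => /(_ sd).
  by rewrite distrC normCE ltcR.
- move=> H; apply/(@cvgrPdist_lt _ _ _ _ (nbhs_filter (z : (C)^o))) => e e0.
  have eR : e = (Re e)%:C by rewrite RRe_real // gtr0_real.
  have [|d d0 dP] := H (Re e); first by rewrite -ltcR -eR.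
  apply/nbhs_ballP; exists d%:C => /=; first by rewrite ltcR.
  move=> s; rewrite /ball /= distrC normCE ltcR => /dP.
  by rewrite -ltcR -eR -normCE distrC.
Qed.

Lemma path_cont_cst c t : path_cont (fun=> c) t.
Proof. exact: cvg_cst. Qed.
Lemma path_contD g h t : path_cont g t -> path_cont h t ->
  path_cont (fun s => g s + h s) t.
Proof. exact: cvgD. Qed.
Lemma path_contM g h t : path_cont g t -> path_cont h t ->
  path_cont (fun s => g s * h s) t.
Proof. exact: continuousM. Qed.
Lemma path_contN g t : path_cont g t -> path_cont (fun s => - g s) t.
Proof. exact: cvgN. Qed.
Lemma path_contV g t : path_cont g t -> g t != 0 -> path_cont (fun s => (g s)^-1) t.
Proof. by move=> cg g0; exact: continuousV. Qed.
Lemma path_cont_comp f g t : path_cont g t -> ccont f (g t) ->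
  path_cont (fun s => f (g s)) t.
Proof. by move=> cg cf; exact: (continuous_comp cg cf). Qed.
Lemma path_cont_reparam g (u : R -> R) t : {for t, continuous u}%classic ->
  path_cont g (u t) -> path_cont (fun s => g (u s)) t.
Proof. by move=> cu cg; exact: (continuous_comp cu cg). Qed.

Lemma ccont_cst c z : ccont (fun=> c) z.
Proof. exact: (@cst_continuous (C : numFieldType)^o (C : numFieldType)^o). Qed.
Lemma ccont_id z : ccont id z.
Proof. by move=> P. Qed.
Lemma ccontD g h t : ccont g t -> ccont h t -> ccont (fun s => g s + h s) t.
Proof. exact: (@continuousD _ _ (C : numFieldType)^o). Qed.
Lemma ccontM g h t : ccont g t -> ccont h t -> ccont (fun s => g s * h s) t.
Proof. exact: continuousM. Qed.
Lemma ccontN g t : ccont g t -> ccont (fun s => - g s) t.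
Proof. exact: (@continuousN _ _ (C : numFieldType)^o). Qed.
Lemma ccontV g t : ccont g t -> g t != 0 -> ccont (fun s => (g s)^-1) t.
Proof. by move=> cg g0; exact: continuousV. Qed.
Lemma ccont_comp f g t : ccont g t -> ccont f (g t) -> ccont (fun s => f (g s)) t.
Proof. by move=> cg cf; exact: (continuous_comp cg cf). Qed.

Lemma path_cont_Re g t : path_cont g t -> {for t, continuous ((fun s => Re (g s)) : R -> R)}%classic.
Proof.
move=> /path_contP cg; rewrite /continuous_at; apply/(@cvgrPdist_lt R (R : realType)^o _ _ (nbhs_filter t)) => e e0.
have [d d0 dP] := cg e e0.
apply/nbhs_ballP; exists d => //= s; rewrite /ball /= distrC => /dP.
rewrite distrC; apply: le_lt_trans; rewrite -raddfB; exact: cnorm_Re.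
Qed.

(** * Lifting square roots along paths *)

(** Continuity here is two-sided even at the endpoints, so it depends on values outside the
    interval. Precomposing with the retraction [clamp] below gets it from [is_path], which is
    continuity within the interval only. *)
Definition cont01 (g : R -> C) : Prop := forall t : R, 0 <= t <= 1 -> path_cont g t.

Lemma lipschitz_cont (u : R -> R) (k t : R) : 0 < k ->
  (forall s, `|u s - u t| <= k * `|s - t|) -> {for t, continuous u}%classic.
Proof.
move=> k0 ku; rewrite /continuous_at.
apply/(@cvgrPdist_lt R (R : realType)^o _ _ (nbhs_filter t)) => e e0.
apply/nbhs_ballP; exists (e / k) => /=; first by rewrite divr_gt0.
move=> s; rewrite /ball /= distrC ltr_pdivlMr // mulrC => /(le_lt_trans (ku s)).
by rewrite distrC.
Qed.

Definition clamp (t : R) : R := if t < 0 then 0 else if 1 < t then 1 else t.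

Lemma clamp01 t : 0 <= clamp t <= 1.
Proof.
by rewrite /clamp; case: ltP => ? //; do ?case: ltP => ? //; lra.
Qed.

Lemma clampK t : 0 <= t <= 1 -> clamp t = t.
Proof.
by move=> /andP[t0 t1]; rewrite /clamp ltNge t0 ltNge t1.
Qed.

Lemma clamp_lipschitz s t : `|clamp s - clamp t| <= `|s - t|.
Proof.
rewrite /clamp; case: (ltP s 0) => ?; case: (ltP t 0) => ?; do ?case: (ltP 1 _) => ?;
  rewrite ler_norml; case: (ger0P (s - t)) => ?; lra.
Qed.

Lemma clamp_cont g : cont01 g -> forall t, path_cont (fun s => g (clamp s)) t.
Proof.
move=> cg t; apply: path_cont_reparam (cg _ (clamp01 t)).
by apply: (@lipschitz_cont _ 1) => // s; rewrite mul1r clamp_lipschitz.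
Qed.

Lemma is_path_cont01 g : is_path g -> cont01 (fun t => g (clamp t)).
Proof.
move=> /subspace_continuousP cg t t01; apply/path_contP => e e0.
have t01' : (`[0, 1]%classic : set R) t by rewrite /= in_itv.
have /cvgrPdist_lt cgt := cg t t01'.
have e0' : 0 < e%:C by rewrite ltcR.
have /nbhs_ballP [d /= d0 dP] := cgt _ e0'.
exists d => // s sd.
have := clamp_lipschitz s t; rewrite (clampK t01) => H.
have := dP (clamp s); rewrite /ball /= in_itv /= clamp01 => /(_ _ isT).
rewrite normCE ltcR cnormB; apply.
by rewrite distrC; exact: le_lt_trans H sd.
Qed.

Lemma cont01_is_path g : cont01 g -> is_path g.
Proof.
move=> cg; rewrite /is_path; apply: continuous_in_subspaceT => t.
by rewrite inE /= in_itv /= => /cg.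
Qed.

(** The intermediate value theorem in the form in which connectedness of the interval is used: once
    for a ratio that can only be 1 or -1, once for a distance that avoids a gap. *)
Lemma sign_const01 (f : R -> R) :
  (forall t, 0 <= t <= 1 -> {for t, continuous f}%classic) ->
  (forall t, 0 <= t <= 1 -> f t != 0) ->
  forall s t, 0 <= s <= 1 -> 0 <= t <= 1 -> 0 < f s -> 0 < f t.
Proof.
move=> cf f0.
have ivt a b : 0 <= a <= 1 -> 0 <= b <= 1 -> a <= b ->
    Num.min (f a) (f b) <= 0 <= Num.max (f a) (f b) -> False.
  move=> /andP[a0 a1] /andP[b0 b1] ab fab.
  have [|c] := @IVT R f a b 0 ab _ fab.
    apply: continuous_in_subspaceT => t; rewrite inE /= in_itv /= => /andP[at_ tb].
    by apply: cf; lra.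
  rewrite in_itv /= => /andP[ac cb] fc0.
  have c01 : 0 <= c <= 1 by lra.
  by have := f0 c c01; rewrite fc0 eqxx.
move=> s t s01 t01 fs; rewrite ltNge; apply/negP => ft.
have [st|/ltW ts] := leP s t.
- by apply: (ivt s t) => //; rewrite ge_min le_max ft orbT (ltW fs).
- by apply: (ivt t s) => //; rewrite ge_min le_max ft (ltW fs) orbT.
Qed.

Lemma lebesgue_number01 (Q : R -> R -> Prop) :
  (forall t, 0 <= t <= 1 -> exists2 d, 0 < d & forall s s',
     0 <= s <= 1 -> 0 <= s' <= 1 -> `|s - t| < d -> `|s' - t| < d -> Q s s') ->
  exists2 d, 0 < d & forall s s',
     0 <= s <= 1 -> 0 <= s' <= 1 -> `|s - s'| < d -> Q s s'.
Proof.
move=> HQ.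
have /compact_near_coveringP cpt := @segment_compact R 0 1.
have := cpt R (nbhs (0 : R)^'+)%classic (fun d t => 0 <= t <= 1 ->
  forall s, 0 <= s <= 1 -> `|s - t| < d -> Q s t) _.
case=> [t|d /= d0 dP].
  rewrite /= in_itv /= => t01.
  have [d d0 dP] := HQ t t01.
  (* Half the local radius: if [t'] is within [d / 2] of [t] and [s] within [d / 2] of [t'], both
     lie within [d] of [t]. *)
  have d2 : 0 < d / 2 by lra.
  near=> t' d' => t'01 s s01 st'.
  have t't : `|t' - t| < d / 2.
    by near: t'; apply/nbhs_ballP; exists (d / 2) => //= x; rewrite /ball /= distrC.
  have d'd : d' < d / 2 by near: d'; exact: nbhs_right_lt.
  apply: dP => //; last by lra.
  have -> : s - t = (s - t') + (t' - t) by ring.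
  apply: le_lt_trans (ler_normD _ _) _.
  by rewrite [d]splitr; apply: ltrD => //; exact: lt_trans st' d'd.
exists (d / 2); first lra.
move=> s s' s01 s'01 ss'.
have d2 : 0 < d / 2 by lra.
have B2 : ball (0 : R) d (d / 2).
  by rewrite /ball /= sub0r normrN gtr0_norm // ltr_pdivrMr // ltr_pMr // ltr1n.
by apply: (dP (d / 2) B2 d2 s' _ s'01 s s01 ss'); rewrite /= in_itv.
Unshelve. all: by end_near.
Qed.

Lemma Re_sqrtc_ge0 (z : C) : 0 <= Re (sqrtc z).
Proof. by case: z => a b /=; exact: sqrtr_ge0. Qed.

Lemma sqrtcK (z : C) : sqrtc z * sqrtc z = z.
Proof. by rewrite -expr2 sqr_sqrtc. Qed.

Lemma Re_sqrtc_gt0 (z : C) : 0 < Re z -> 0 < Re (sqrtc z).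
Proof.
move=> z0; rewrite lt_neqAle Re_sqrtc_ge0 andbT eq_sym; apply/eqP => s0.
move: z0; rewrite -{1}(sqrtcK z); case: (sqrtc z) s0 => a b /= ->.
by rewrite mul0r sub0r oppr_gt0 ltNge -expr2 sqr_ge0.
Qed.

(** The difference of two roots is the difference of the squares divided by the sum of the roots.
    Principal roots have nonnegative real part, so that sum has norm at least [Re (sqrtc z)]. *)
Lemma ccont_sqrtc z : 0 < Re z -> ccont (@sqrtc R) z.
Proof.
move=> z0; have r0 := Re_sqrtc_gt0 z0.
apply/ccontP => e e0; exists (e * Re (sqrtc z)); first by rewrite mulr_gt0.
move=> s; rewrite -{1}(sqrtcK s) -{1}(sqrtcK z).
have -> : sqrtc s * sqrtc s - sqrtc z * sqrtc z =
   (sqrtc s - sqrtc z) * (sqrtc s + sqrtc z) by ring.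
rewrite cnormM => H.
have H1 : Re (sqrtc z) <= cnorm (sqrtc s + sqrtc z).
  apply: le_trans (cnorm_Re _); rewrite raddfD /= ger0_norm.
    by have := Re_sqrtc_ge0 s; lra.
  by have := Re_sqrtc_ge0 s; lra.
rewrite -(ltr_pM2r r0); apply: le_lt_trans H.
by rewrite ler_wpM2l // cnorm_ge0.
Qed.

Lemma Re_div_gt0 (x y : C) : cnorm (x - y) < cnorm y -> 0 < Re (x / y).
Proof.
move=> xy; have y0 : y != 0 by rewrite -cnorm_gt0; apply: le_lt_trans xy; exact: cnorm_ge0.
have : cnorm (x / y - 1) < 1.
  have -> : x / y - 1 = (x - y) / y by field.
  by rewrite cnormM cnormV ltr_pdivrMr ?mul1r // cnorm_gt0.
move=> /(le_lt_trans (cnorm_Re _)); rewrite raddfB /= ltr_norml; lra.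
Qed.

Lemma path_cont_prod (I : Type) (r : seq I) (f : I -> R -> C) t :
  (forall i, path_cont (f i) t) -> path_cont (fun s => \prod_(i <- r) f i s) t.
Proof.
move=> cf; elim: r => [|i r IHr].
  have -> : (fun s => \prod_(i <- [::]) f i s) = (fun=> 1).
    by apply/funext => s; rewrite big_nil.
  exact: path_cont_cst.
have -> : (fun s => \prod_(j <- i :: r) f j s) = (fun s => f i s * \prod_(j <- r) f j s).
  by apply/funext => s; rewrite big_cons.
exact: path_contM.
Qed.

(* The ratio [G t / G 0] telescopes into ratios of values at nearby times, each
   in the right half plane, where the principal square root is continuous. *)
Lemma sqrt_lift (G : R -> C) (k0 : C) : cont01 G ->
  (forall t, 0 <= t <= 1 -> G t != 0) -> k0 * k0 = G 0 ->
  exists k, [/\ cont01 k, forall t, 0 <= t <= 1 -> k t * k t = G t & k 0 = k0].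
Proof.
move=> cG G0 k00.
have [|d d0 dP] := @lebesgue_number01 (fun s s' => 0 < Re (G s / G s')).
  (* A third suffices: [G s] and [G s'] then differ by less than two thirds of [|G t|], while
     [|G s'|] exceeds two thirds of it. *)
  move=> t t01; have Gt0 : 0 < cnorm (G t) / 3 by rewrite divr_gt0 ?cnorm_gt0 ?G0.
  have [d d0 dP] := (path_contP _ _).1 (cG t t01) _ Gt0.
  exists d => // s s' _ _ /dP Hs /dP Hs'; apply: Re_div_gt0.
  have H1 := cnorm_dist (G s) (G t) (G s').
  have H2 := cnorm_dist (G t) (G s') 0; rewrite !subr0 in H2.
  rewrite (cnormB (G t)) in H1; rewrite (cnormB (G t)) in H2; lra.
pose N := (archimedean.Num.bound d^-1).+1.
have N0 : 0 < N%:R :> R by rewrite ltr0n.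
have Nd : N%:R^-1 < d.
  rewrite invf_plt ?posrE //; apply: lt_le_trans (archi_boundP _) _.
    by rewrite invr_ge0 ltW.
  by rewrite ler_nat /N leqnSn.
(* These nodes subdivide [[0, t]] rather than [[0, 1]]: the number of factors is the same for all
   [t], and each factor varies continuously with [t]. *)
pose u (i : nat) (t : R) := i%:R * t / N%:R.
have u01 i t : (i <= N)%N -> 0 <= t <= 1 -> 0 <= u i t <= 1.
  move=> iN /andP[t0 t1]; rewrite /u divr_ge0 ?mulr_ge0 ?ler0n //=.
  rewrite ler_pdivrMr // mul1r -[leRHS]mulr1 ler_pM ?ler0n // ler_nat //.
have uS i t : 0 <= t <= 1 -> `|u i.+1 t - u i t| < d.
  move=> /andP[t0 t1]; apply: le_lt_trans Nd.
  have -> : u i.+1 t - u i t = t / N%:R by rewrite /u -natr1; field; rewrite ?lt0r_neq0.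
  rewrite ger0_norm ?divr_ge0 ?ler0n //.
  by rewrite ler_pdivrMr // mulVf // lt0r_neq0.
have cu i t : (i <= N)%N -> 0 <= t <= 1 -> path_cont (fun s => G (u i s)) t.
  move=> iN t01; apply: path_cont_reparam (cG _ (u01 _ _ iN t01)).
  apply: (@lipschitz_cont _ ((i%:R + 1) / N%:R)).
    by rewrite divr_gt0 // ltr_wpDl ?ler0n.
  move=> s; have -> : u i s - u i t = i%:R / N%:R * (s - t) by rewrite /u; ring.
  rewrite normrM ger0_norm ?divr_ge0 ?ler0n // ler_wpM2r //.
  by rewrite ler_wpM2r ?invr_ge0 ?ler0n // lerDl.
have ratio i t : (i < N)%N -> 0 <= t <= 1 -> 0 < Re (G (u i.+1 t) / G (u i t)).
  by move=> iN t01; apply: dP; rewrite ?u01 ?uS // ltnW.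
exists (fun t => k0 * \prod_(i <- index_enum 'I_N) sqrtc (G (u i.+1 t) / G (u i t))); split.
- move=> t t01; apply: path_contM; first exact: path_cont_cst.
  apply: path_cont_prod => i.
  apply: (@path_cont_comp (@sqrtc R) (fun s => G (u i.+1 s) / G (u i s))).
    apply: path_contM; first by apply: cu.
    apply: path_contV; first by apply: cu => //; exact: ltnW.
    by apply: G0; apply: u01 => //; exact: ltnW.
  by apply: ccont_sqrtc; exact: ratio.
- move=> t t01.
  set P := \prod_(i <- _) _.
  have -> : k0 * P * (k0 * P) = (k0 * k0) * (P * P) by ring.
  rewrite k00 /P -big_split /=.
  under eq_bigr do rewrite sqrtcK.
  rewrite -(big_mkord xpredT (fun i => G (u i.+1 t) / G (u i t))).
  rewrite (@telescope_prodf _ 0 N (fun i => G (u i t))) //.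
    have -> : u N t = t by rewrite /u; field; rewrite lt0r_neq0.
    have -> : u 0%N t = 0 by rewrite /u; ring.
    by rewrite mulrC mulfVK // G0 // lexx ler01.
  by move=> i /andP[_ iN]; apply: G0; apply: u01 => //; exact: ltnW.
- rewrite big1 ?mulr1 // => i _.
  have -> : u i.+1 0 = 0 by rewrite /u mulr0 mul0r.
  have -> : u i 0 = 0 by rewrite /u mulr0 mul0r.
  by rewrite divff ?sqrtc1 // G0 // lexx ler01.
Qed.

(** * Two-sheeted covers of the disc *)

Lemma cnorm_real (x : R) : cnorm x%:C = `|x|.
Proof. by apply: complexI; rewrite -normCE normc_def /= expr0n addr0 sqrtr_sqr. Qed.

Lemma path_cont_real (u : R -> R) t : {for t, continuous u}%classic ->
  path_cont (fun s => (u s)%:C) t.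
Proof.
rewrite /continuous_at => /(@cvgrPdist_lt R (R : realType)^o _ _ (nbhs_filter t)) cu.
apply/path_contP => e e0; have /nbhs_ballP [d /= d0 dP] := cu _ e0.
exists d => // s sd.
suff : cnorm (u s - u t)%:C < e by rewrite rmorphB.
rewrite cnorm_real; have := dP s; rewrite /ball /= distrC => /(_ sd).
by rewrite distrC.
Qed.

(* [psi] and [phi] are automorphisms of the disc that turn [B] into [z ^+ 2]. *)
Definition square_cover (B : C -> C) (u : C) : Prop :=
  exists psi psi' phi : C -> C,
  [/\ forall z, in_disc z -> in_disc (psi z) /\ ccont psi z,
      forall z, in_disc z -> in_disc (psi' z) /\ ccont psi' z,
      forall z, in_disc z -> psi' (psi z) = z /\ psi (psi' z) = z,
      forall z, in_disc z -> in_disc (phi z) /\ ccont phi z &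
   [/\ forall z w, in_disc z -> in_disc w -> phi z = phi w -> z = w,
       forall z, in_disc z -> in_disc (B z) /\ phi (B z) = psi z * psi z &
       in_disc u /\ phi u = 0]] /\
  (forall z, in_disc z -> exists q : C -> C, [/\ ccont q z,
     forall y, in_disc y -> B y - B z = q y * (y - z) & q z = 0 -> B z = u]) /\
  (forall x w, in_disc x -> in_disc w -> exists y,
     [/\ in_disc y, B y = w & cnorm (x - y) ^+ 2 <= 2 * cnorm (B x - w)]).

Definition is_lift (F : C -> C) (g : R -> C) (x : C) (h : R -> C) : Prop :=
  [/\ cont01 h, forall t, 0 <= t <= 1 -> in_disc (h t) /\ F (h t) = g t & h 0 = x].

Lemma in01_0 : 0 <= (0 : R) <= 1. Proof. by rewrite lexx ler01. Qed.
Lemma in01_1 : 0 <= (1 : R) <= 1. Proof. by rewrite lexx ler01. Qed.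
#[local] Hint Resolve in01_0 in01_1 : core.

Lemma in_disc_sqr k : in_disc (k * k) -> in_disc k.
Proof. by rewrite !in_discE cnormM => H; have := cnorm_ge0 k; nra. Qed.

Lemma in_disc_open x : in_disc x ->
  exists2 d, 0 < d & forall y, cnorm (y - x) < d -> in_disc y.
Proof.
rewrite in_discE => x1; exists (1 - cnorm x); first lra.
move=> y yx; rewrite in_discE; have := cnorm_dist y x 0; rewrite !subr0; lra.
Qed.

Lemma half_nontrivial (t : R) : (t == 0) || (1 - t == 0) -> 1 - 2 * t = 0 -> False.
Proof. by move=> /orP[]/eqP; lra. Qed.

Section SquareCover.
Variables (B : C -> C) (u : C).
Hypothesis cB : square_cover B u.

Lemma square_cover_disc z : in_disc z -> in_disc (B z).
Proof. by case: cB => psi [psi' [phi [[_ _ _ _ [_ H _]] _]]] /H[]. Qed.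

Lemma square_cover_base : in_disc u.
Proof. by case: cB => psi [psi' [phi [[_ _ _ _ [_ _ []]]]]]. Qed.

Lemma square_cover_ccont z : in_disc z -> ccont B z.
Proof.
move=> zD; case: cB => psi [psi' [phi [_ [H _]]]].
have [q [cq qE _]] := H z zD.
have cf : ccont (fun y => q y * (y - z) + B z) z.
  apply: ccontD; last exact: ccont_cst.
  apply: ccontM => //; apply: ccontD; [exact: ccont_id|exact: ccont_cst].
have [d0 d00 d0P] := in_disc_open zD.
apply/ccontP => e /((ccontP _ _).1 cf) [d dgt dP].
exists (Num.min d d0); first by rewrite lt_min dgt.
move=> s; rewrite lt_min => /andP[/dP sd /d0P sD].
by move: sd; rewrite -qE // subrK subrr mulr0 add0r.
Qed.

Lemma square_cover_path h : cont01 h -> (forall t, 0 <= t <= 1 -> in_disc (h t)) ->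
  cont01 (fun t => B (h t)).
Proof.
move=> ch hD t t01; apply: path_cont_comp; first exact: ch.
by apply: square_cover_ccont; exact: hD.
Qed.

(** In coordinates the lift is a square root of [phi (g t)]. This never vanishes, since [phi] is
    injective on the disc with zero [u]; the root starting at [psi x] is carried back by [psi']. *)
Lemma square_cover_lift g x : cont01 g ->
  (forall t, 0 <= t <= 1 -> in_disc (g t) /\ g t <> u) ->
  in_disc x -> B x = g 0 -> exists h, is_lift B g x h.
Proof.
move=> cg gD xD Bx.
case: cB => psi [psi' [phi [[Hpsi Hpsi' psiK Hphi [phiI HB [uD phiu]]] _]]].
have [|||k [ck kk k0]] := @sqrt_lift (fun t => phi (g t)) (psi x).
- by move=> t t01; apply: path_cont_comp; [exact: cg | exact: (Hphi _ (gD t t01).1).2].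
- move=> t t01; apply/eqP; rewrite -phiu => /phiI E.
  by apply: (gD t t01).2; apply: E => //; exact: (gD t t01).1.
- by rewrite -Bx (HB x xD).2.
have kD t : 0 <= t <= 1 -> in_disc (k t).
  by move=> t01; apply: in_disc_sqr; rewrite kk //; exact: (Hphi _ (gD t t01).1).1.
exists (fun t => psi' (k t)); split.
- by move=> t t01; apply: path_cont_comp; [exact: ck | exact: (Hpsi' _ (kD t t01)).2].
- move=> t t01; have hD := (Hpsi' _ (kD t t01)).1; split=> //.
  apply: phiI; [exact: (HB _ hD).1 | exact: (gD t t01).1 |].
  by rewrite (HB _ hD).2 (psiK _ (kD t t01)).2 kk.
- by rewrite k0 (psiK _ xD).1.
Qed.

(** The quotient [psi (h r) / psi (h' r)] is continuous with values 1 and -1, so its real part keeps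
    its sign. *)
Lemma square_cover_lift_uniq h h' : cont01 h -> cont01 h' ->
  (forall t, 0 <= t <= 1 -> [/\ in_disc (h t), in_disc (h' t), B (h t) = B (h' t) &
     B (h t) <> u]) ->
  forall s t, 0 <= s <= 1 -> 0 <= t <= 1 -> h s = h' s -> h t = h' t.
Proof.
move=> ch ch' hh' s t s01 t01 hs.
case: cB => psi [psi' [phi [[Hpsi Hpsi' psiK Hphi [phiI HB [uD phiu]]] _]]].
have kk' r : 0 <= r <= 1 -> psi (h r) * psi (h r) = psi (h' r) * psi (h' r).
  move=> r01; have [hD hD' E _] := hh' r r01.
  by rewrite -(HB _ hD).2 -(HB _ hD').2 E.
have k'0 r : 0 <= r <= 1 -> psi (h' r) != 0.
  move=> r01; have [hD hD' E neu] := hh' r r01.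
  apply/eqP => p0; apply: neu; rewrite E; apply: phiI => //.
    exact: (HB _ hD').1.
  by rewrite (HB _ hD').2 p0 mul0r phiu.
have kE r : 0 <= r <= 1 ->
    psi (h r) / psi (h' r) = 1 \/ psi (h r) / psi (h' r) = -1.
  move=> r01; have /eqP := kk' r r01; rewrite -!expr2 eqf_sqr => /orP[]/eqP ->.
    by left; rewrite divff ?k'0.
  by right; rewrite mulNr divff ?k'0.
have := @sign_const01 (fun r => Re (psi (h r) / psi (h' r))) _ _ s t s01 t01.
rewrite hs divff ?k'0 //= ltr01 => H.
have {}H : 0 < Re (psi (h t) / psi (h' t)).
  apply: H => // r r01; last first.
    by case: (kE r r01) => -> /=; rewrite ?oppr_eq0 oner_eq0.
  apply: path_cont_Re; have [hD hD' _ _] := hh' r r01.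
  apply: path_contM.
    by apply: path_cont_comp; [exact: ch | exact: (Hpsi _ hD).2].
  apply: path_contV (k'0 r r01).
  by apply: path_cont_comp; [exact: ch' | exact: (Hpsi _ hD').2].
have [hD hD' _ _] := hh' t t01.
rewrite -(psiK _ hD).1 -(psiK _ hD').1; congr psi'.
case: (kE t t01) => E; last by move: H; rewrite E /= oppr_gt0 ltr10.
by rewrite -[LHS](divfK (k'0 t t01)) E mul1r.
Qed.

(** Two points with the same value have equal or opposite [psi]. Opposite values cannot both lie
    within [|psi x|] of [psi x], because their distances to it sum to at least [2 |psi x|]. *)
Lemma square_cover_local_inj x : in_disc x -> B x <> u ->
  exists2 e, 0 < e & forall y y', in_disc y -> in_disc y' ->
    cnorm (y - x) < e -> cnorm (y' - x) < e -> B y = B y' -> y = y'.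
Proof.
move=> xD Bxu.
case: cB => psi [psi' [phi [[Hpsi Hpsi' psiK Hphi [phiI HB [uD phiu]]] _]]].
have p0 : 0 < cnorm (psi x).
  rewrite cnorm_gt0; apply/eqP => p0; apply: Bxu; apply: phiI => //.
    exact: (HB _ xD).1.
  by rewrite (HB _ xD).2 p0 mul0r phiu.
have [e e0 eP] := (ccontP _ _).1 (Hpsi _ xD).2 _ p0.
exists e => // y y' yD y'D /eP yx /eP y'x E.
rewrite -(psiK _ yD).1 -(psiK _ y'D).1; congr psi'.
have /eqP : psi y * psi y = psi y' * psi y'.
  by rewrite -(HB _ yD).2 -(HB _ y'D).2 E.
rewrite -!expr2 eqf_sqr => /orP[]/eqP // E'.
have := cnormD (psi y - psi x) (psi y' - psi x).
have -> : psi y - psi x + (psi y' - psi x) = - (psi x + psi x) by rewrite E'; ring.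
have -> : psi x + psi x = 2%:R * psi x by ring.
rewrite cnormN cnormM.
have -> : cnorm 2%:R = 2.
  by apply: complexI; rewrite -normCE ger0_norm // rmorph_nat.
by move=> H; have := le_lt_trans H (ltrD yx y'x); rewrite mulr_natl mulr2n ltxx.
Qed.

Lemma square_cover_fibre w : in_disc w -> w <> u ->
  exists r : bool -> C, injective r /\
    forall x, (in_disc x /\ B x = w) <-> exists b, x = r b.
Proof.
move=> wD wu.
case: cB => psi [psi' [phi [[Hpsi Hpsi' psiK Hphi [phiI HB [uD phiu]]] _]]].
pose k := sqrtc (phi w).
have kk : k * k = phi w by rewrite /k sqrtcK.
have k0 : k != 0.
  by apply/eqP => k0; apply: wu; apply: phiI => //; rewrite -kk k0 mul0r.
pose s (b : bool) := if b then - k else k.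
have ss b : s b * s b = phi w by rewrite /s; case: b; rewrite ?mulrNN.
have sD b : in_disc (s b) by apply: in_disc_sqr; rewrite ss; exact: (Hphi _ wD).1.
exists (fun b => psi' (s b)); split.
  move=> b b' E; have : s b = s b'.
    by rewrite -(psiK _ (sD b)).2 -(psiK _ (sD b')).2 E.
  rewrite /s; case: b b' {E} => -[] //.
    by move=> /eqP; rewrite eq_sym -addr_eq0 -mulr2n mulrn_eq0 /= (negPf k0).
  by move=> /eqP; rewrite -addr_eq0 -mulr2n mulrn_eq0 /= (negPf k0).
move=> x; split=> [[xD Bx]|[b ->]].
  have /eqP : psi x * psi x = k * k by rewrite -(HB _ xD).2 Bx kk.
  rewrite -!expr2 eqf_sqr => /orP[]/eqP E.
    by exists false; rewrite /= -E (psiK _ xD).1.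
  by exists true; rewrite /= -E (psiK _ xD).1.
have hD := (Hpsi' _ (sD b)).1; split=> //.
by apply: phiI => //; [exact: (HB _ hD).1 | rewrite (HB _ hD).2 (psiK _ (sD b)).2 ss].
Qed.

Lemma square_cover_finite (s : seq C) : exists s' : seq C,
  forall x, in_disc x -> B x \in s -> x \in s'.
Proof.
case: cB => psi [psi' [phi [[Hpsi Hpsi' psiK Hphi [phiI HB [uD phiu]]] _]]].
exists ([seq psi' (sqrtc (phi w)) | w <- s] ++ [seq psi' (- sqrtc (phi w)) | w <- s]).
move=> x xD xs; rewrite mem_cat.
have /eqP : psi x * psi x = sqrtc (phi (B x)) * sqrtc (phi (B x)).
  by rewrite sqrtcK (HB _ xD).2.
rewrite -!expr2 eqf_sqr => /orP[]/eqP E; apply/orP; [left|right]; apply/mapP;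
  by exists (B x) => //; rewrite -E (psiK _ xD).1.
Qed.

(* A half turn around the branch point joins two points of the same fibre. *)
Lemma square_cover_branch : exists c, [/\ in_disc c, B c = u,
  forall x, in_disc x -> B x = u -> x = c &
  forall e, 0 < e -> exists k, [/\ cont01 k,
    forall t, 0 <= t <= 1 -> [/\ in_disc (k t), cnorm (k t - c) < e & k t <> c],
    B (k 0) = B (k 1) & k 0 <> k 1]].
Proof.
case: cB => psi [psi' [phi [[Hpsi Hpsi' psiK Hphi [phiI HB [uD phiu]]] _]]].
have D0 : in_disc 0 by rewrite in_discE cnorm0 ltr01.
have cD := (Hpsi' _ D0).1.
exists (psi' 0); split=> //.
- apply: phiI => //; first exact: (HB _ cD).1.
  by rewrite (HB _ cD).2 (psiK _ D0).2 mul0r phiu.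
- move=> x xD Bx; have := (HB _ xD).2; rewrite Bx phiu => /esym/eqP.
  by rewrite mulf_eq0 orbb => /eqP <-; rewrite (psiK _ xD).1.
move=> e /((ccontP _ _).1 (Hpsi' _ D0).2) [d d0 dP].
pose m : R := Num.min d 1 / 4.
have [m0 md m1] : [/\ 0 < m, m * 4 <= d & m * 4 <= 1].
  rewrite /m divfK ?pnatr_eq0 // !ge_min !lexx orbT; split=> //.
  by rewrite divr_gt0 // lt_min d0 ltr01.
clearbody m.
(* A parabolic arc from [m] to [- m] replaces the half circle. Its real part vanishes only at
   [t = 1/2], where the imaginary part does not, so it misses 0; its norm is at most [2 m], which is
   below both [d] and 1. *)
pose a (t : R) : R := m * (1 - 2 * t).
pose b (t : R) : R := m * (t * (1 - t)).
pose K t : C := (a t)%:C + 'i%C * (b t)%:C.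
have Kn t : 0 <= t <= 1 -> cnorm (K t) < m * 4.
  move=> /andP[t0 t1]; apply: le_lt_trans (cnormD _ _) _; rewrite cnormM.
  have -> : cnorm 'i%C = 1 by apply: complexI; rewrite -normCE normc_def /= expr0n add0r expr1n sqrtr1.
  have tt1 : 0 <= t * (1 - t) <= 1 by apply/andP; split; nra.
  have [tt0 tt2] := andP tt1.
  have a2 : `|a t| <= m.
    rewrite /a normrM gtr0_norm // ler_piMr ?(ltW m0) // ler_norml.
    by apply/andP; split; lra.
  have b2 : `|b t| <= m.
    by rewrite /b normrM gtr0_norm // ler_piMr ?(ltW m0) // ger0_norm.
  rewrite !cnorm_real; lra.
have KD t : 0 <= t <= 1 -> in_disc (K t).
  by move=> /Kn Kt; rewrite in_discE; lra.
have Re_im (x y : R) : Re (x%:C + 'i%C * y%:C) = x by rewrite /=; ring.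
have Im_im (x y : R) : Im (x%:C + 'i%C * y%:C) = y by rewrite /=; ring.
have K0 t : 0 <= t <= 1 -> K t <> 0.
  move=> /andP[t0 t1] E.
  have /eqP : a t = 0 by rewrite -(Re_im (a t) (b t)) -/(K t) E.
  have /eqP : b t = 0 by rewrite -(Im_im (a t) (b t)) -/(K t) E.
  rewrite /a /b !mulf_eq0 (gt_eqF m0) /= => tE /eqP.
  exact: half_nontrivial.
have KE : K 1 = - K 0.
  have a1 : a 1 = - a 0 by rewrite /a; ring.
  have b1 : b 1 = 0 by rewrite /b; ring.
  have b0 : b 0 = 0 by rewrite /b; ring.
  by rewrite /K b1 b0 a1 rmorph0 mulr0 !addr0 rmorphN.
exists (fun t => psi' (K t)); split.
- move=> t t01; apply: path_cont_comp; last exact: (Hpsi' _ (KD _ t01)).2.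
  apply: path_contD; last apply: path_contM; first last.
  + have -> : (fun s => (b s)%:C) = (fun s => m%:C * (s%:C * (1 - s)%:C)).
      by apply/funext => s; rewrite /b !rmorphM.
    apply: path_contM; first exact: path_cont_cst.
    apply: path_contM; apply: path_cont_real; apply: (@lipschitz_cont _ 1) => // s.
      by rewrite mul1r.
    rewrite mul1r (_ : 1 - s - (1 - t) = - (s - t)); last by ring.
    by rewrite normrN.
  + exact: path_cont_cst.
  apply: path_cont_real; apply: (@lipschitz_cont _ (m * 2)); first by rewrite mulr_gt0.
  move=> s; have -> : a s - a t = - (m * 2) * (s - t) by rewrite /a; ring.
  have m2 : 0 < m * 2 by rewrite mulr_gt0.
  by rewrite normrM normrN (gtr0_norm m2).
- move=> t t01; split; first exact: (Hpsi' _ (KD _ t01)).1.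
    by apply: dP; rewrite subr0; have := Kn t t01; lra.
  by move=> /(congr1 psi); rewrite (psiK _ (KD t t01)).2 (psiK _ D0).2; exact: K0.
- have [h0 h1] := ((Hpsi' _ (KD 0 in01_0)).1, (Hpsi' _ (KD 1 in01_1)).1).
  apply: phiI; [exact: (HB _ h0).1 | exact: (HB _ h1).1 |].
  by rewrite (HB _ h0).2 (HB _ h1).2 !(psiK _ (KD _ _)).2 // KE mulrNN.
- move=> /(congr1 psi); rewrite !(psiK _ (KD _ _)).2 // KE => /eqP.
  by rewrite -addr_eq0 -mulr2n mulrn_eq0 /= => /eqP; exact: K0.
Qed.

End SquareCover.

(** * Operations on paths *)

Lemma real_complex0 : (0 : R)%:C = 0 :> C. Proof. by []. Qed.
Lemma real_complex1 : (1 : R)%:C = 1 :> C. Proof. by []. Qed.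

Lemma uniform_radius (T : eqType) (s : seq T) (P : T -> R -> Prop) :
  (forall x d d', 0 < d' -> d' <= d -> P x d -> P x d') ->
  (forall x, x \in s -> exists2 d, 0 < d & P x d) ->
  exists2 d, 0 < d & forall x, x \in s -> P x d.
Proof.
move=> Pmono; elim: s => [|x s IHs] H; first by exists 1.
have [|d d0 dP] := IHs; first by move=> y ys; apply: H; rewrite inE ys orbT.
have [d' d'0 d'P] := H x (mem_head _ _).
have m0 : 0 < Num.min d d' by rewrite lt_min d0.
exists (Num.min d d') => // y; rewrite inE => /orP[/eqP ->|/dP Py].
  by apply: Pmono d'P; rewrite // ge_min lexx orbT.
by apply: Pmono Py; rewrite // ge_min lexx.
Qed.

Lemma path_cont_norm g u (k : R) t : path_cont g t ->
  {for t, continuous ((fun s => k - cnorm (g s - u)) : R -> R)}%classic.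
Proof.
move=> /path_contP cg; rewrite /continuous_at.
apply/(@cvgrPdist_lt R (R : realType)^o _ _ (nbhs_filter t)) => e /cg [d d0 dP].
apply/nbhs_ballP; exists d => //= s; rewrite /ball /= distrC => /dP.
apply: le_lt_trans; rewrite ler_norml.
have := cnorm_dist (g s) (g t) u; have := cnorm_dist (g t) (g s) u.
rewrite (cnormB (g t) (g s)) => *; apply/andP; split; lra.
Qed.

Definition path_rev (g : R -> C) (t : R) : C := g (1 - t).
(** Writing concatenation as a sum avoids gluing two continuous pieces: on each half one of the two
    clamped arguments is stationary, and its term cancels against [g 1], on the left half because
    [g 1 = h 0]. *)
Definition path_cat (g h : R -> C) (t : R) : C :=
  g (clamp (2 * t)) + (h (clamp (2 * t - 1)) - g 1).

Lemma path_catL g h t : g 1 = h 0 -> 0 <= t <= 1 -> t <= 1 / 2 ->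
  path_cat g h t = g (2 * t) /\ 0 <= 2 * t <= 1.
Proof.
move=> gh /andP[t0 t1] t2.
have t01 : 0 <= 2 * t <= 1 by apply/andP; split; lra.
rewrite /path_cat (clampK t01) {1}/clamp.
case: ltP => [_|H]; first by rewrite gh subrr addr0.
have -> : 2 * t - 1 = 0 by lra.
by rewrite ltNge ler01 /= gh subrr addr0.
Qed.

Lemma path_catR g h t : 0 <= t <= 1 -> 1 / 2 <= t ->
  path_cat g h t = h (2 * t - 1) /\ 0 <= 2 * t - 1 <= 1.
Proof.
move=> /andP[t0 t1] t2.
have t01 : 0 <= 2 * t - 1 <= 1 by apply/andP; split; lra.
rewrite /path_cat (clampK t01) {1}/clamp.
case: ltP => [H|_]; first by lra.
case: ltP => [_|H]; first by rewrite addrC subrK.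
have -> : 2 * t = 1 by lra.
by rewrite addrC subrK subrr lexx ler01.
Qed.

Lemma path_cat_ind (P : C -> Prop) g h t : g 1 = h 0 ->
  (forall s, 0 <= s <= 1 -> P (g s)) -> (forall s, 0 <= s <= 1 -> P (h s)) ->
  0 <= t <= 1 -> P (path_cat g h t).
Proof.
move=> gh Pg Ph t01; have [tle|/ltW tge] := leP t (1 / 2).
  by have [-> ?] := path_catL gh t01 tle; exact: Pg.
by have [-> ?] := path_catR g h t01 tge; exact: Ph.
Qed.

Lemma path_cat0 g h : g 1 = h 0 -> path_cat g h 0 = g 0.
Proof.
move=> gh; have h0 : (0 : R) <= 1 / 2 by lra.
by have [-> _] := path_catL gh in01_0 h0; rewrite mulr0.
Qed.

Lemma path_cat1 g h : path_cat g h 1 = h 1.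
Proof.
have h1 : (1 : R) / 2 <= 1 by lra.
by have [-> _] := path_catR g h in01_1 h1; congr h; ring.
Qed.

Lemma path_rev0 g : path_rev g 0 = g 1. Proof. by rewrite /path_rev subr0. Qed.
Lemma path_rev1 g : path_rev g 1 = g 0. Proof. by rewrite /path_rev subrr. Qed.

Lemma in01_rev (t : R) : 0 <= t <= 1 -> 0 <= 1 - t <= 1.
Proof. by move=> /andP[? ?]; apply/andP; split; lra. Qed.

Lemma cont01_rev g : cont01 g -> cont01 (path_rev g).
Proof.
move=> cg t t01; apply: (@path_cont_reparam g (fun s => 1 - s)); last exact: cg _ (in01_rev t01).
apply: (@lipschitz_cont _ 1) => // s.
rewrite mul1r (_ : 1 - s - (1 - t) = - (s - t)); last by ring.
by rewrite normrN.
Qed.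

Lemma cont01_cat g h : cont01 g -> cont01 h -> cont01 (path_cat g h).
Proof.
move=> cg ch t t01; apply: path_contD; last apply: path_contD.
- apply: (@path_cont_reparam (fun s => g (clamp s)) (fun s => 2 * s)).
    apply: (@lipschitz_cont _ 2) => // s.
    by rewrite -mulrBr normrM gtr0_norm.
  exact: clamp_cont.
- apply: (@path_cont_reparam (fun s => h (clamp s)) (fun s => 2 * s - 1)).
    apply: (@lipschitz_cont _ 2) => // s.
    rewrite (_ : 2 * s - 1 - (2 * t - 1) = 2 * (s - t)); last by ring.
    by rewrite normrM gtr0_norm.
  exact: clamp_cont.
- exact: path_cont_cst.
Qed.

Lemma is_lift_rev F g x h : is_lift F g x h ->
  is_lift F (path_rev g) (h 1) (path_rev h).
Proof.
move=> [ch Fh _]; split; first exact: cont01_rev.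
  by move=> t t01; exact: Fh (in01_rev t01).
exact: path_rev0.
Qed.

Lemma is_lift_cat F g x h g' h' : is_lift F g x h -> is_lift F g' (h 1) h' ->
  is_lift F (path_cat g g') x (path_cat h h').
Proof.
move=> [ch Fh h0] [ch' Fh' h'0].
have gg' : g 1 = g' 0 by rewrite -(Fh 1 in01_1).2 -(Fh' 0 in01_0).2 h'0.
split; first exact: cont01_cat.
  move=> t t01; have [tle|/ltW tge] := leP t (1 / 2).
    have [-> s01] := path_catL (esym h'0) t01 tle.
    by have [-> _] := path_catL gg' t01 tle; exact: Fh.
  have [-> s01] := path_catR h h' t01 tge.
  by have [-> _] := path_catR g g' t01 tge; exact: Fh'.
by rewrite path_cat0 // h'0.
Qed.

(* The arcs [x + (y - x) * (t + i * s * t * (1 - t))] are pairwise disjoint away from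
   their endpoints, so a small [s] makes the arc miss the finite set. *)
Lemma disc_avoiding_path (Z : seq C) x y : in_disc x -> in_disc y ->
  x \notin Z -> y \notin Z -> exists p, [/\ cont01 p, p 0 = x, p 1 = y &
    forall t, 0 <= t <= 1 -> in_disc (p t) /\ p t \notin Z].
Proof.
move=> xD yD xZ yZ; have [<-|xy] := eqVneq x y.
  by exists (fun=> x); split=> // t _; exact: path_cont_cst.
have yx0 : y - x != 0 by rewrite subr_eq0 eq_sym.
pose q z := (z - x) / (y - x).
(* The normalisation [q] sends [x] to 0 and [y] to 1. If [z] lies on the arc of parameter [s], away
   from the endpoints, then [s] must be [sl z]; so each point of [Z] rules out a single value. *)
pose sl z := Im (q z) / (Re (q z) * (1 - Re (q z))).
have [||d d0 dP] := @uniform_radius _ Z (fun z d => forall s, 0 < s -> s < d -> s != sl z).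
  + by move=> z d d' _ dd' H s s0 sd'; apply: H => //; exact: lt_le_trans dd'.
  + move=> z _; have [sz0|sz0] := ltP 0 (sl z).
      by exists (sl z) => // s _; rewrite lt_neqAle => /andP[].
    by exists 1 => // s s0 _; rewrite gt_eqF //; exact: le_lt_trans s0.
(* The segment stays in the disc of radius [mu], and the arc deviates from it by at most [2 s],
   because [|y - x| <= 2]. Hence [4 s <= 1 - mu] keeps the arc in the unit disc. *)
pose mu := Num.max (cnorm x) (cnorm y).
have [mux muy mu1] : [/\ cnorm x <= mu, cnorm y <= mu & mu < 1].
  by rewrite /mu !le_max gt_max !lexx orbT -!in_discE xD yD.
clearbody mu.
pose s := Num.min (d / 2) ((1 - mu) / 4).
have [s0 sd smu] : [/\ 0 < s, s < d & s * 4 <= 1 - mu].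
  rewrite /s; split; [|by rewrite gt_min ltr_pdivrMr // ltr_pMr // ltr1n|].
    by rewrite lt_min !divr_gt0 // subr_gt0.
  by rewrite -ler_pdivlMr // ge_min lexx orbT.
clearbody s.
pose p t : C := x + (y - x) * (t%:C + 'i%C * (s * (t * (1 - t)))%:C).
exists p; split.
- move=> t t01; apply: path_contD; first exact: path_cont_cst.
  apply: path_contM; first exact: path_cont_cst.
  have cid : path_cont (fun s => s%:C) t.
    by apply: path_cont_real; apply: (@lipschitz_cont _ 1) => // r; rewrite mul1r.
  apply: path_contD => //; apply: path_contM; first exact: path_cont_cst.
  have -> : (fun r => (s * (r * (1 - r)))%:C) = (fun r => s%:C * (r%:C * (1 - r%:C))).
    by apply/funext => r; rewrite !rmorphM rmorphB.
  apply: path_contM; first exact: path_cont_cst.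
  apply: path_contM => //; apply: path_contD; first exact: path_cont_cst.
  exact: path_contN.
- by rewrite /p mul0r mulr0 real_complex0 mulr0 addr0 mulr0 addr0.
- by rewrite /p subrr !mulr0 real_complex1 addr0 mulr1 addrC subrK.
move=> t /andP[t0 t1]; split.
  have -> : p t = (1 - t)%:C * x + (t%:C * y + (y - x) * ('i%C * (s * (t * (1 - t)))%:C)).
    by rewrite /p rmorphB; ring.
  rewrite in_discE; apply: le_lt_trans (cnormD _ _) _.
  have := cnormD (t%:C * y) ((y - x) * ('i%C * (s * (t * (1 - t)))%:C)).
  rewrite !cnormM; have -> : cnorm 'i%C = 1.
    by apply: complexI; rewrite -normCE normc_def /= expr0n add0r expr1n sqrtr1.
  rewrite !cnorm_real mul1r.
  have tt : 0 <= t * (1 - t) <= 1 by apply/andP; split; nra.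
  have [tt0 tt1] := andP tt.
  have t'0 : 0 <= 1 - t by lra.
  rewrite (ger0_norm t0) (ger0_norm t'0) (ger0_norm (mulr_ge0 (ltW s0) tt0)).
  have := cnormD y (- x); rewrite cnormN => yxn.
  have A1 : (1 - t) * cnorm x <= (1 - t) * mu by rewrite ler_wpM2l.
  have A2 : t * cnorm y <= t * mu by rewrite ler_wpM2l.
  have A3 : cnorm (y - x) * (s * (t * (1 - t))) <= 2 * s.
    apply: ler_pM; rewrite ?cnorm_ge0 ?mulr_ge0 ?(ltW s0) //; first lra.
    by rewrite ler_piMr // ltW.
  lra.
apply/negP => pZ; have := dP _ pZ s s0 sd; rewrite /sl.
have -> : q (p t) = t%:C + 'i%C * (s * (t * (1 - t)))%:C.
  by rewrite /q /p addrAC subrr add0r mulrAC mulfV // mul1r.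
have Re_im (a b : R) : Re (a%:C + 'i%C * b%:C) = a by rewrite /=; ring.
have Im_im (a b : R) : Im (a%:C + 'i%C * b%:C) = b by rewrite /=; ring.
(* The quotient [sl] recovers [s] unless [t * (1 - t) = 0]; in that case the point is [x] or [y],
   which are outside [Z] by hypothesis. *)
rewrite Re_im Im_im mulfK ?eqxx // mulf_eq0; apply/negP => /orP[]/eqP tE.
  by move: pZ xZ; rewrite /p tE mul0r mulr0 real_complex0 mulr0 addr0 mulr0 addr0 => ->.
have {}tE : t = 1 by apply/eqP; rewrite eq_sym -subr_eq0 tE.
move: pZ yZ; rewrite /p tE subrr !mulr0 real_complex1 addr0 mulr1 addrC subrK.
by move=> ->.
Qed.

(** * Towers of two-sheeted covers *)

Local Notation tower := (seq ((C -> C) * C)).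

(** The head of the list is the innermost factor, applied first, so that induction on the list peels
    off [B_1]. *)
Definition composite (L : tower) (x : C) : C := foldl (fun x p => p.1 x) x L.

Fixpoint covers (L : tower) : Prop :=
  if L is p :: L' then square_cover p.1 p.2 /\ covers L' else True.

(* The critical value of the factor [p.1] is [p.2]; [vals] lists its images
   under the subsequent factors, i.e. the critical values of [composite L]. *)
Fixpoint vals (L : tower) : seq C :=
  if L is p :: L' then composite L' p.2 :: vals L' else [::].

Fixpoint noncrit (L : tower) (x : C) : Prop :=
  if L is p :: L' then p.1 x <> p.2 /\ noncrit L' (p.1 x) else True.

Lemma comp_disc L x : covers L -> in_disc x -> in_disc (composite L x).
Proof.
elim: L x => [|[B u] L IHL] x //= [cB cL] xD.
by apply: IHL => //; exact: (square_cover_disc cB).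
Qed.

Lemma comp_ccont L x : covers L -> in_disc x -> ccont (composite L) x.
Proof.
elim: L x => [|[B u] L IHL] x /= cL xD; first exact: ccont_id.
case: cL => cB cL; apply: (@ccont_comp (composite L) B).
  exact: (square_cover_ccont cB).
by apply: IHL => //; exact: (square_cover_disc cB).
Qed.

Lemma comp_path L h : covers L -> cont01 h ->
  (forall t, 0 <= t <= 1 -> in_disc (h t)) -> cont01 (fun t => composite L (h t)).
Proof.
move=> cL ch hD t t01; apply: path_cont_comp; first exact: ch.
by apply: comp_ccont => //; exact: hD.
Qed.

Lemma noncrit_vals L x : composite L x \notin vals L -> noncrit L x.
Proof.
elim: L x => [|[B u] L IHL] x //=; rewrite inE negb_or => /andP[xu /IHL ?].
by split=> // E; move: xu; rewrite /composite /= E eqxx.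
Qed.

(** Lift through the outer factors first, then through [B]. The intermediate path never meets [u],
    since its image [g] would then meet the head of [vals]. *)
Lemma comp_lift L g x : covers L -> cont01 g ->
  (forall t, 0 <= t <= 1 -> in_disc (g t) /\ g t \notin vals L) ->
  in_disc x -> composite L x = g 0 -> exists h, is_lift (composite L) g x h.
Proof.
elim: L x => [|[B u] L IHL] x /= cL cg gD xD xg.
  by exists g; split=> // t /gD[].
case: cL => cB cL; have BxD := square_cover_disc cB xD.
have [|h [ch Lh h0]] := IHL (B x) cL cg _ BxD xg.
  by move=> t /gD[]; rewrite inE negb_or => ? /andP[].
have [|k [ck Bk k0]] := square_cover_lift cB ch _ xD (esym h0).
  move=> t t01; split; first exact: (Lh t t01).1.
  move=> hu; have := (gD t t01).2; rewrite inE negb_or => /andP[].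
  by rewrite -(Lh t t01).2 hu eqxx.
exists k; split=> // t t01; split; first exact: (Bk t t01).1.
by rewrite /composite /= (Bk t t01).2; exact: (Lh t t01).2.
Qed.

Lemma comp_lift_uniq L h h' : covers L -> cont01 h -> cont01 h' ->
  (forall t, 0 <= t <= 1 -> [/\ in_disc (h t), in_disc (h' t),
     composite L (h t) = composite L (h' t) & composite L (h t) \notin vals L]) ->
  forall s t, 0 <= s <= 1 -> 0 <= t <= 1 -> h s = h' s -> h t = h' t.
Proof.
elim: L h h' => [|[B u] L IHL] h h' /= cL ch ch' hh' s t s01 t01 hs.
  by have [_ _] := hh' t t01.
case: cL => cB cL.
have HB r : 0 <= r <= 1 -> B (h r) = B (h' r).
  move=> r01; apply: (IHL (fun r => B (h r)) (fun r => B (h' r)) cL _ _ _ s r) => //;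
    last by rewrite hs.
  - by apply: (square_cover_path cB) => // q /hh'[].
  - by apply: (square_cover_path cB) => // q /hh'[].
  move=> q /hh'[hD h'D E]; rewrite inE negb_or => /andP[_ nv].
  by split=> //; exact: (square_cover_disc cB).
apply: (square_cover_lift_uniq cB ch ch' _ s01 t01 hs) => r r01.
have [hD h'D _] := hh' r r01; rewrite inE negb_or => /andP[nv _]; split=> //.
  exact: HB.
by move=> E; move: nv; rewrite /composite /= E eqxx.
Qed.

Lemma is_lift_uniq L g x y h h' : covers L ->
  (forall t, 0 <= t <= 1 -> g t \notin vals L) ->
  is_lift (composite L) g x h -> is_lift (composite L) g y h' ->
  forall s t, 0 <= s <= 1 -> 0 <= t <= 1 -> h s = h' s -> h t = h' t.
Proof.
move=> cL gV [ch Lh _] [ch' Lh' _]; apply: (comp_lift_uniq cL ch ch') => t t01.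
have [[-> E] [-> E']] := (Lh t t01, Lh' t t01).
by rewrite E E' gV.
Qed.

Lemma comp_finite L (V : seq C) : covers L ->
  exists Z : seq C, forall x, in_disc x -> composite L x \in V -> x \in Z.
Proof.
elim: L => [|[B u] L IHL] /= cL; first by exists V.
case: cL => cB /IHL [Z ZP].
have [Z' Z'P] := square_cover_finite cB Z.
by exists Z' => x xD xV; apply: Z'P => //; apply: ZP => //; exact: (square_cover_disc cB).
Qed.

(** Nearness to the fibre of [w], with [d] uniform in [x] and [w]. By the quadratic bound of a
    factor, precision [e ^+ 2 / 2] after it gives precision [e] before it. *)
Lemma comp_proper L e : covers L -> 0 < e -> exists2 d, 0 < d &
  forall x w, in_disc x -> in_disc w -> cnorm (composite L x - w) < d ->
    exists y, [/\ in_disc y, composite L y = w & cnorm (x - y) < e].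
Proof.
elim: L e => [|[B u] L IHL] e /= cL e0.
  by exists e => // x w xD wD H; exists w; split.
case: cL => cB cL.
have [|d d0 dP] := IHL (e ^+ 2 / 2) cL; first by rewrite divr_gt0 ?exprn_gt0.
exists d => // x w xD wD /dP [] //; first exact: (square_cover_disc cB).
move=> y [yD Ly xy].
case: cB => psi [psi' [phi [_ [_ H]]]].
have [z [zD Bz xz]] := H x y xD yD.
exists z; split=> //; first by rewrite /composite /= Bz.
rewrite -(ltr_pXn2r (n := 2)) ?nnegrE ?cnorm_ge0 ?(ltW e0) //.
apply: le_lt_trans xz _; rewrite -ltr_pdivlMl // mulrC //.
Qed.

Lemma comp_local_inj L x : covers L -> in_disc x -> noncrit L x ->
  exists2 e, 0 < e & forall y y', in_disc y -> in_disc y' ->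
    cnorm (y - x) < e -> cnorm (y' - x) < e -> composite L y = composite L y' -> y = y'.
Proof.
elim: L x => [|[B u] L IHL] x /= cL xD nx; first by exists 1.
case: cL nx => cB cL [xu nx].
have [e e0 eP] := square_cover_local_inj cB xD xu.
have [d d0 dP] := IHL _ cL (square_cover_disc cB xD) nx.
have [d' d'0 d'P] := (ccontP _ _).1 (square_cover_ccont cB xD) _ d0.
exists (Num.min e d'); first by rewrite lt_min e0.
move=> y y' yD y'D; rewrite !lt_min => /andP[ye yd] /andP[y'e y'd] E.
apply: eP => //; apply: dP; rewrite ?(square_cover_disc cB) //; exact: d'P.
Qed.

(** The lift of a small loop stays near the finite fibre over [w] and, being connected, near a
    single point [y] of it. If [y] is not critical, the composite is injective near [y], so the two
    ends of the lift, having equal images, coincide. *)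
Lemma comp_small_loop L w e : covers L -> in_disc w -> 0 < e ->
  exists2 d, 0 < d & forall g x h, is_lift (composite L) g x h -> g 0 = g 1 ->
    (forall t, 0 <= t <= 1 -> cnorm (g t - w) < d) ->
    exists y, [/\ in_disc y, composite L y = w, cnorm (x - y) < e & noncrit L y -> h 0 = h 1].
Proof.
move=> cL wD e0.
have [Y YP] := comp_finite [:: w] cL.
have {}YP y : in_disc y -> composite L y = w -> y \in Y.
  by move=> yD yw; apply: YP => //; rewrite yw inE.
have [||r r0 rP] := @uniform_radius _ Y
    (fun y d => forall y', y' \in Y -> y' != y -> d <= cnorm (y' - y)).
  + by move=> y d d' _ dd' H y' y'Y ne; apply: le_trans dd' _; exact: H.
  + move=> y _; apply: (@uniform_radius _ Y (fun y' d => y' != y -> d <= cnorm (y' - y))).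
      by move=> y' d d' _ dd' H ne; apply: le_trans dd' _; exact: H.
    move=> y' _; have [->|ne] := eqVneq y' y; first by exists 1.
    by exists (cnorm (y' - y)); rewrite // cnorm_gt0 subr_eq0.
have [||i i0 iP] := @uniform_radius _ Y (fun y d => in_disc y -> noncrit L y ->
    forall z z', in_disc z -> in_disc z' -> cnorm (z - y) < d -> cnorm (z' - y) < d ->
    composite L z = composite L z' -> z = z').
  + move=> y d d' _ dd' H yD ny z z' zD z'D zy z'y; apply: H => //.
      exact: lt_le_trans dd'.
    exact: lt_le_trans dd'.
  + move=> y _; have [[yD ny]|H] := pselect (in_disc y /\ noncrit L y).
      by have [d d0 dP] := comp_local_inj cL yD ny; exists d.
    by exists 1 => // yD ny; case: H.
pose e' := Num.min e (Num.min (r / 4) i).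
have e'0 : 0 < e' by rewrite !lt_min e0 i0 divr_gt0.
have [e'e e'r e'i] : [/\ e' <= e, e' * 4 <= r & e' <= i].
  by rewrite -ler_pdivlMr // /e' !ge_min !lexx !orbT.
clearbody e'.
have [d d0 dP] := comp_proper cL e'0.
exists d => // g x h [ch Lh h0] g01 gd.
have near t : 0 <= t <= 1 -> exists y, [/\ in_disc y, composite L y = w & cnorm (h t - y) < e'].
  move=> t01; have [hD E] := Lh t t01.
  by apply: dP => //; rewrite E; exact: gd.
have [y [yD yw hy]] := near 0 in01_0.
exists y; split=> //; first by rewrite -h0; exact: lt_le_trans e'e.
(* Distinct points of the fibre are at least [4 e'] apart, so the distance to [y] never takes a
   value in [[e', 3 e')]; in particular it never equals [2 e'], and the lift cannot leave [y]. *)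
have far t : 0 <= t <= 1 -> cnorm (h t - y) < e' \/ e' * 3 <= cnorm (h t - y).
  move=> t01; have [z [zD zw hz]] := near t t01.
  have [zy|zy] := eqVneq z y; first by left; rewrite -zy.
  right; have := rP _ (YP _ yD yw) _ (YP _ zD zw) zy.
  have := cnorm_dist z (h t) y; rewrite (cnormB z (h t)) => H1 H2.
  move: hz e'r H1 H2; clear; lra.
have H1 : cnorm (h 1 - y) < e'.
  have := @sign_const01 (fun t => e' * 2 - cnorm (h t - y)) _ _ 0 1 in01_0 in01_1.
  case: (far 1 in01_1) => [//|H] K; exfalso.
  suff : 0 < e' * 2 - cnorm (h 1 - y) by move: H e'0; clear; lra.
  apply: K.
  - by move=> t t01; apply: path_cont_norm; exact: ch.
  - by move=> t /far[]; move: e'0; clear; [move=> ? ? |move=> ? ?]; apply/eqP; lra.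
  by move: hy e'0; clear; lra.
move=> ny.
apply: (iP _ (YP _ yD yw) yD ny); rewrite ?(Lh _ in01_0).1 ?(Lh _ in01_1).1 //.
- exact: lt_le_trans e'i.
- exact: lt_le_trans e'i.
- by rewrite (Lh _ in01_0).2 (Lh _ in01_1).2.
Qed.

(** * Monodromy of a tower *)

(** The bit flip in the definition of the wreath product is automatic. A permutation that acts on
    tails through [h] sends the two strings over a tail to two distinct strings over its image,
    hence keeps or exchanges their head bits; [f] is read off at head bit [false]. *)
Lemma wreathZ2S m (s : {perm m.+1.-tuple bool}) :
  s \in wreathZ2 m.+1 <->
  exists2 h, h \in wreathZ2 m & forall t, behead_tuple (s t) = h (behead_tuple t).
Proof.
have beheadK b (t : m.-tuple bool) : behead_tuple (cons_tuple b t) = t by exact: val_inj.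
have theadK b (t : m.-tuple bool) : thead (cons_tuple b t) = b by [].
have eta (t : m.+1.-tuple bool) : t = cons_tuple (thead t) (behead_tuple t).
  by rewrite {1}[t]tuple_eta.
rewrite inE; split.
  move=> /existsP[f /existsP[h /andP[hW /forallP H]]]; exists h => // t.
  by have /forallP/(_ (behead_tuple t))/eqP := H (thead t); rewrite -eta => ->.
move=> [h hW H]; apply/existsP; exists [ffun t => thead (s (cons_tuple false t))].
apply/existsP; exists h; rewrite hW /=.
apply/forallP => b; apply/forallP => t; apply/eqP; rewrite ffunE.
rewrite [LHS]eta H beheadK; congr (cons_tuple _ _).
case: b => //=.
have : s (cons_tuple true t) != s (cons_tuple false t).
  by rewrite (inj_eq perm_inj); apply/eqP => /(congr1 (@thead _ _)); rewrite !theadK.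
rewrite [s (cons_tuple true t)]eta [s (cons_tuple false t)]eta !H !beheadK !theadK.
by case: (thead _); case: (thead _) => //; rewrite eqxx.
Qed.

(* The base group [Z2 ^ X_m] is generated by the swaps of one pair of siblings. *)
Lemma tail_preserving_gen m (M : {perm m.+1.-tuple bool} -> Prop) :
  M 1%g -> (forall s s', M s -> M s' -> M (s * s')%g) ->
  (forall t0, exists s : {perm m.+1.-tuple bool},
     [/\ M s, forall t, behead_tuple t != t0 -> s t = t &
     s (cons_tuple false t0) = cons_tuple true t0]) ->
  forall s : {perm m.+1.-tuple bool},
    (forall t, behead_tuple (s t) = behead_tuple t) -> M s.
Proof.
move=> M1 MM Mswap s.
have beheadK b (t : m.-tuple bool) : behead_tuple (cons_tuple b t) = t by exact: val_inj.
have theadK b (t : m.-tuple bool) : thead (cons_tuple b t) = b by [].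
have eta (t : m.+1.-tuple bool) : t = cons_tuple (thead t) (behead_tuple t).
  by rewrite {1}[t]tuple_eta.
(* Induction on the number of tails over which [s] exchanges the two strings. *)
have [n] := ubnP #|[set t | s (cons_tuple false t) != cons_tuple false t]|.
elim: n s => // n IHn s; rewrite ltnS => sn stail.
have [s0|[t0]] := set_0Vmem [set t | s (cons_tuple false t) != cons_tuple false t].
  suff -> : s = 1%g by [].
  have sF t : s (cons_tuple false t) = cons_tuple false t.
    by apply/eqP; have := finset.in_set0 t; rewrite -s0 inE => /negbFE.
  apply/permP => t; rewrite perm1 [t]eta; case: (thead t) => //.
  rewrite [LHS]eta stail beheadK; congr (cons_tuple _ _).
  have : s (cons_tuple true (behead_tuple t)) != s (cons_tuple false (behead_tuple t)).
    by rewrite (inj_eq perm_inj); apply/eqP => /(congr1 (@thead _ _)); rewrite !theadK.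
  rewrite sF {1}[s _]eta stail beheadK; case: (thead _) => //; by rewrite eqxx.
rewrite inE => st0; have [g [Mg gfix gt0]] := Mswap t0.
have gtail t : behead_tuple (g t) = behead_tuple t.
  have [t_t0|/gfix -> //] := eqVneq (behead_tuple t) t0.
  have [->//|gt] := eqVneq (behead_tuple (g t)) t0.
  by have /perm_inj -> := gfix _ gt.
have gVtail t : behead_tuple (g^-1%g t) = behead_tuple t by rewrite -gtail permKV.
have st0E : s (cons_tuple false t0) = cons_tuple true t0.
  move: st0; rewrite [s _]eta stail beheadK; case: (thead _) => //; by rewrite eqxx.
have -> : s = (s * g^-1 * g)%g by rewrite mulgKV.
apply: MM => //; apply: IHn; last by move=> t; rewrite permM gVtail.
apply: leq_trans sn; apply: proper_card; apply/properP; split.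
  apply/fintype.subsetP => t; rewrite !inE permM; apply: contraNneq => sE.
  have [tt0|tt0] := eqVneq t t0.
    by move: sE; rewrite tt0 st0E => /(congr1 (@thead _ _)); rewrite !theadK.
  by rewrite sE; apply/eqP/(@perm_inj _ g); rewrite permKV gfix // beheadK.
by exists t0; rewrite !inE // permM st0E -gt0 permK eqxx.
Qed.

Definition lifts_to (F : C -> C) (g : R -> C) (x y : C) : Prop :=
  exists2 h, is_lift F g x h & h 1 = y.

Definition loop_off (V : seq C) (g : R -> C) : Prop :=
  [/\ cont01 g, forall t, 0 <= t <= 1 -> in_disc (g t) /\ g t \notin V, g 0 = 0 & g 1 = 0].

Definition codes (T : finType) (F : C -> C) (code : T -> C) : Prop :=
  injective code /\ forall x, (in_disc x /\ F x = 0) <-> exists t, x = code t.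

Definition mono (T : finType) (F : C -> C) (V : seq C) (code : T -> C)
    (s : {perm T}) : Prop :=
  exists2 g, loop_off V g & forall t, lifts_to F g (code t) (code (s t)).

Section LiftsTo.
Variables (L : tower) (V : seq C).
Hypotheses (cL : covers L) (LV : {subset vals L <= V}).

Lemma notin_vals g : loop_off V g -> forall t, 0 <= t <= 1 -> g t \notin vals L.
Proof. by move=> [_ gV _ _] t /gV[_]; apply: contra => /LV. Qed.

Lemma lifts_to_inj g x x' y y' : loop_off V g ->
  lifts_to (composite L) g x y -> lifts_to (composite L) g x' y' -> x = x' <-> y = y'.
Proof.
move=> /notin_vals gV [h hl <-] [h' hl' <-].
have U := is_lift_uniq cL gV hl hl'.
have [[_ _ <-] [_ _ <-]] := (hl, hl').
by split=> /U; apply.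
Qed.

(** Lifting defines a map from the finite fibre to itself; it is injective because lifts are also
    determined by their endpoints. *)
Lemma loop_perm (T : finType) (code : T -> C) g :
  codes (composite L) code -> loop_off V g ->
  exists s : {perm T}, forall t, lifts_to (composite L) g (code t) (code (s t)).
Proof.
move=> [codeI codeP] gV.
have [f fP] : {f : T -> T & forall t, lifts_to (composite L) g (code t) (code (f t))}.
  apply: (boolp.choice (P := fun t t' => lifts_to (composite L) g (code t) (code t'))) => t.
  have [cg gD g0 g1] := gV.
  have [tD Lt] := (codeP (code t)).2 (ex_intro _ t erefl).
  have [||h hl] := @comp_lift L g (code t) cL cg _ tD.
  - by move=> s s01; split; [exact: (gD s s01).1 | exact: (notin_vals gV)].
  - by rewrite Lt g0.
  have [ch Lh h0] := hl.
  have [t' ht'] : exists t', h 1 = code t'.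
    by apply/codeP; split; [exact: (Lh 1 in01_1).1 | rewrite (Lh 1 in01_1).2].
  by exists t', h.
have fI : injective f.
  by move=> t t' E; apply/codeI/(lifts_to_inj gV (fP t) (fP t')).2; rewrite E.
by exists (perm fI) => t; rewrite permE.
Qed.

End LiftsTo.

(** The product of permutations applies its left factor first, which matches the order of
    concatenation. *)
Lemma mono_mul (T : finType) F V (code : T -> C) s s' :
  mono F V code s -> mono F V code s' -> mono F V code (s * s')%g.
Proof.
move=> [g [cg gV g0 g1] gl] [g' [cg' gV' g'0 g'1] gl'].
have gg' : g 1 = g' 0 by rewrite g1.
exists (path_cat g g').
  split; [exact: cont01_cat | | by rewrite path_cat0 | by rewrite path_cat1].
  by move=> t; apply: (@path_cat_ind (fun x => in_disc x /\ x \notin V)).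
move=> t; rewrite permM; have [h hl h1] := gl t; have [h' hl' h'1] := gl' (s t).
exists (path_cat h h'); last by rewrite path_cat1.
by apply: is_lift_cat => //; rewrite h1.
Qed.

Lemma mono1 (T : finType) F V (code : T -> C) : 0 \notin V ->
  codes F code -> mono F V code 1%g.
Proof.
move=> V0 [_ codeP]; exists (fun=> 0).
  by split=> // t _; [exact: path_cont_cst | rewrite in_discE cnorm0 ltr01].
move=> t; rewrite perm1; exists (fun=> code t) => //.
by split=> // r _; [exact: path_cont_cst | apply/codeP; exists t].
Qed.

(* The loop is the image of a path that runs from [codeB t0 false] to a point near
   the branch point of [B], makes a half turn around it and returns. *)
Lemma swap_loop (T : finType) (B : C -> C) (u : C) (L : tower) (V : seq C)
    (code : T -> C) (codeB : T -> bool -> C) :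
  covers ((B, u) :: L) -> uniq (vals ((B, u) :: L)) ->
  {subset vals ((B, u) :: L) <= V} -> 0 \notin V ->
  codes (composite L) code ->
  (forall t, injective (codeB t) /\
     forall x, (in_disc x /\ B x = code t) <-> exists b, x = codeB t b) ->
  forall t0, exists2 g, loop_off V g &
    lifts_to (composite ((B, u) :: L)) g (codeB t0 false) (codeB t0 true) /\
    forall t b, t != t0 ->
      lifts_to (composite ((B, u) :: L)) g (codeB t b) (codeB t b).
Proof.
set L' := (B, u) :: L; set F := composite L'.
move=> cL' uv vV V0 [codeI codeP] codeBP t0.
have [cB cL] : square_cover B u /\ covers L := cL'.
have LE x : F x = composite L (B x) by [].
pose v := composite L u.
have vvals : v \notin vals L by case/andP: uv.
have uD := square_cover_base cB.
have vD : in_disc v by exact: comp_disc.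
have codeD t : in_disc (code t) /\ composite L (code t) = 0 by apply/codeP; exists t.
have codeBD t b : in_disc (codeB t b) /\ B (codeB t b) = code t.
  by apply/(codeBP t).2; exists b.
have F0 t b : F (codeB t b) = 0 by rewrite LE (codeBD t b).2 (codeD t).2.
have [c [cD Bc cuniq cturn]] := square_cover_branch cB.
have Fc : F c = v by rewrite LE Bc.
have [Z0 Z0P] := comp_finite V cL'.
(* A path in the disc has its [F]-image off [V] exactly when it avoids [Z]. *)
pose Z := [seq z <- Z0 | F z \in V].
have ZP x : in_disc x -> (x \in Z) = (F x \in V).
  by move=> xD; rewrite mem_filter; case: (boolP (F x \in V)) => //= /Z0P ->.
(* As [vals] has no repetition, [v] is not in [vals L], so the outer composite is injective near
   [u]. *)
have [eu eu0 euP] := comp_local_inj cL uD (noncrit_vals vvals).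
have [e1 e10 e1P] := (ccontP _ _).1 (square_cover_ccont cB cD) _ eu0.
have [||e2 e20 e2P] := @uniform_radius _ Z (fun z d => z != c -> d <= cnorm (z - c)).
  + by move=> z d d' _ dd' H zc; apply: le_trans dd' _; exact: H.
  + move=> z _; have [->|zc] := eqVneq z c; first by exists 1.
    by exists (cnorm (z - c)); rewrite // cnorm_gt0 subr_eq0.
have [d d0 dP] := comp_small_loop cL' vD e10.
have [e3 e30 e3P] := (ccontP _ _).1 (comp_ccont cL' cD) _ d0.
have [|k [ck kP kB k01]] := cturn (Num.min e1 (Num.min e2 e3)).
  by rewrite !lt_min e10 e20.
have {}kP t : 0 <= t <= 1 ->
    [/\ in_disc (k t), k t \notin Z, cnorm (B (k t) - u) < eu & cnorm (F (k t) - v) < d].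
  move=> /kP[kD]; rewrite !lt_min => /and3P[k1 k2 k3] kc; split=> //.
  - apply/negP => /e2P H; have /H : k t != c by apply/eqP.
    by rewrite leNgt k2.
  - by rewrite -{1}Bc; exact: e1P.
  - by rewrite -Fc; exact: e3P.
have xD := (codeBD t0 false).1.
have xZ : codeB t0 false \notin Z by rewrite ZP // F0.
have [yD yZ yu _] := kP 0 in01_0.
have [p [cp p0 p1 pP]] := disc_avoiding_path xD yD xZ yZ.
pose P := fun t => F (p t); pose Q := fun t => F (k t).
have cP : cont01 P by apply: comp_path => // t /pP[].
have cQ : cont01 Q by apply: comp_path => // t /kP[].
have PD t : 0 <= t <= 1 -> in_disc (P t) /\ P t \notin V.
  by move=> /pP[pD pZ]; split; [exact: comp_disc | rewrite -ZP].
have QD t : 0 <= t <= 1 -> in_disc (Q t) /\ Q t \notin V.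
  by move=> /kP[kD kZ _ _]; split; [exact: comp_disc | rewrite -ZP].
have P0 : P 0 = 0 by rewrite /P p0 F0.
have PQ : P 1 = Q 0 by rewrite /P p1.
have Q01 : Q 0 = Q 1 by rewrite /Q !LE kB.
have QR : path_cat P Q 1 = path_rev P 0 by rewrite path_cat1 path_rev0 PQ Q01.
have notvals (g : R -> C) (gV : forall t, 0 <= t <= 1 -> in_disc (g t) /\ g t \notin V) t :
    0 <= t <= 1 -> in_disc (g t) /\ g t \notin vals L'.
  by move=> /gV[gD H]; split=> //; apply: contra H => /vV.
have rPD t : 0 <= t <= 1 -> in_disc (path_rev P t) /\ path_rev P t \notin V.
  by move=> t01; exact: PD (in01_rev t01).
have liftB g x h : is_lift F g x h -> is_lift (composite L) g (B x) (fun t => B (h t)).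
  move=> [ch hP h0]; split; last by rewrite h0.
    by apply: (square_cover_path cB) => // t /hP[].
  by move=> t /hP[hD <-]; split=> //; exact: (square_cover_disc cB).
have valsL (g : R -> C) (gV : forall t, 0 <= t <= 1 -> in_disc (g t) /\ g t \notin V) t :
    0 <= t <= 1 -> g t \notin vals L.
  by move=> t01; have [_] := notvals g gV t t01; rewrite inE negb_or => /andP[].
have pl : is_lift F P (codeB t0 false) p by split=> // t /pP[].
have kl : is_lift F Q (p 1) k by split=> [//|t /kP[]//|]; rewrite p1.
exists (path_cat (path_cat P Q) (path_rev P)).
  split.
  - by apply: cont01_cat; [exact: cont01_cat | exact: cont01_rev].
  - move=> t; apply: (@path_cat_ind (fun x => in_disc x /\ x \notin V)) => // s.
    exact: (@path_cat_ind (fun x => in_disc x /\ x \notin V)).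
  - by rewrite !path_cat0.
  - by rewrite path_cat1 path_rev1.
split.
  have [k1D _ _ _] := kP 1 in01_1.
  have [|h hl] := @comp_lift L' (path_rev P) (k 1) cL' (cont01_rev cP) (notvals _ rPD) k1D.
    by rewrite -QR path_cat1.
  have hB : B (h 1) = code t0.
    (* Under [B] both ends of the half turn agree, so on the way back the [B]-image retraces that of
       [p] and returns to [code t0]. *)
    have l1 := liftB _ _ _ hl; have l2 := is_lift_rev (liftB _ _ _ pl).
    have [_ _ h0] := hl.
    rewrite (is_lift_uniq cL (valsL _ rPD) l1 l2 in01_0 in01_1).
      by rewrite path_rev1 p0 (codeBD t0 false).2.
    by rewrite path_rev0 h0 p1 kB.
  have [ch hP h0] := hl.
  have [b hb] : exists b, h 1 = codeB t0 b.
    by apply/(codeBP t0).2; split; [exact: (hP 1 in01_1).1|].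
  exists (path_cat (path_cat p k) h).
    apply: is_lift_cat; first by apply: is_lift_cat.
    by rewrite path_cat1.
  (* Ending at [codeB t0 false] would make [h] the reverse of [p], whence [k 1 = k 0], against the
     choice of the half turn. *)
  rewrite path_cat1 hb; case: b hb => // hb; case: k01.
  have nv t (t01 : 0 <= t <= 1) := (notvals _ rPD t t01).2.
  have := is_lift_uniq cL' nv hl (is_lift_rev pl) in01_1 in01_0.
  by rewrite path_rev1 path_rev0 p0 p1 h0 hb => ->.
move=> t b tt0.
have [|q ql] := @comp_lift L' P (codeB t b) cL' cP (notvals _ PD) (codeBD t b).1.
  by rewrite P0 -/F F0.
have [cq qP q0] := ql.
have [q1D q1E] := qP 1 in01_1.
have [|r rl] := @comp_lift L' Q (q 1) cL' cQ (notvals _ QD) q1D.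
  by rewrite q1E.
have Qd s : 0 <= s <= 1 -> cnorm (Q s - v) < d by move=> /kP[].
have [y [yD' Fy qy yclosed]] := dP _ _ _ rl Q01 Qd.
have [cr rP r0] := rl.
(* The lift [r] of the turn stays near a point [y] over [v]. If [y] were critical it would be [c],
   since [v] is not in [vals L]. Then [B (q 1)] and [B (k 0)] would be near [u] with equal images,
   hence equal, and lifting [P] backwards from there would give [t = t0]. *)
have r01 : r 0 = r 1.
  have LBy : composite L (B y) = v := Fy.
  apply: yclosed; split=> /=; last by apply: noncrit_vals; rewrite LBy.
  move=> Byu; have yc := cuniq y yD' Byu.
  have Bq1 : B (q 1) = B (k 0).
    apply: euP => //; rewrite ?(square_cover_disc cB) //.
      by rewrite -{1}Bc; apply: e1P; rewrite -yc.
    by have := q1E; rewrite PQ.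
  move/eqP: tt0; apply; apply: codeI.
  have := is_lift_uniq cL (valsL _ PD) (liftB _ _ _ ql) (liftB _ _ _ pl) in01_1 in01_0.
  by rewrite p1 q0 p0 (codeBD t b).2 (codeBD t0 false).2; apply.
exists (path_cat (path_cat q r) (path_rev q)); last by rewrite path_cat1 path_rev1.
apply: is_lift_cat; first exact: is_lift_cat.
by rewrite path_cat1 -r01 r0; exact: is_lift_rev ql.
Qed.

Lemma tower_monodromy (L : tower) (V : seq C) :
  covers L -> uniq (vals L) -> {subset vals L <= V} -> 0 \notin V ->
  exists code : (size L).-tuple bool -> C, codes (composite L) code /\
    forall s, mono (composite L) V code s <-> s \in wreathZ2 (size L).
Proof.
elim: L => [|[B u] L IHL] cL uL LV V0.
  have D0 : in_disc 0 by rewrite in_discE cnorm0 ltr01.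
  have cd : codes (composite [::]) (fun _ : 0.-tuple bool => 0).
    split=> [t t' _|x]; first by rewrite [t]tuple0 [t']tuple0.
    by split=> [[_ E]|[_ ->] //]; exists [tuple].
  exists (fun=> 0); split=> // s.
  have -> : s = 1%g by apply/permP => t; rewrite [LHS]tuple0 [RHS]tuple0.
  by split=> _; [rewrite /= inE | exact: mono1].
have [cB cL'] : square_cover B u /\ covers L := cL; have [_ uL'] := andP uL.
have LV' : {subset vals L <= V} by move=> x xL; apply: LV; rewrite inE xL orbT.
have [code [codeC codeW]] := IHL cL' uL' LV' V0.
have [codeI codeP] := codeC.
have codeD t : in_disc (code t) /\ composite L (code t) = 0 by apply/codeP; exists t.
have [codeB codeBP] : {codeB : (size L).-tuple bool -> bool -> C & forall t,
    injective (codeB t) /\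
    forall x, (in_disc x /\ B x = code t) <-> exists b, x = codeB t b}.
  apply: (boolp.choice (P := fun t r => injective r /\
    forall x, (in_disc x /\ B x = code t) <-> exists b, x = r b)) => t.
  apply: (square_cover_fibre cB); first exact: (codeD t).1.
  move=> tu; move: V0; rewrite LV // inE -(codeD t).2 tu; by rewrite eqxx.
have codeBD t b : in_disc (codeB t b) /\ B (codeB t b) = code t.
  by apply/(codeBP t).2; exists b.
pose T := (size L).+1.-tuple bool.
have beheadK b (t : (size L).-tuple bool) : behead_tuple (cons_tuple b t) = t.
  exact: val_inj.
have eta (t : T) : t = cons_tuple (thead t) (behead_tuple t).
  by rewrite {1}[t]tuple_eta.
(* The tail codes the [B]-value and the head bit selects the sheet, in agreement with the action on
   strings in [wreathZ2]. *)
pose code' (t : T) := codeB (behead_tuple t) (thead t).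
have code'B t : B (code' t) = code (behead_tuple t) by exact: (codeBD _ _).2.
have code'E b t : code' (cons_tuple b t) = codeB t b by rewrite /code' beheadK.
have codeC' : codes (composite ((B, u) :: L)) code'.
  split.
    move=> t t' E; have tE : behead_tuple t = behead_tuple t'.
      by apply: codeI; rewrite -!code'B E.
    rewrite [t]eta [t']eta tE; congr (cons_tuple _ _).
    by move: E; rewrite /code' tE => /(codeBP _).1.
  move=> x; split=> [[xD Lx]|[t ->]].
    have [t Bt] : exists t, B x = code t.
      by apply/codeP; split=> //; exact: (square_cover_disc cB).
    have [b xb] : exists b, x = codeB t b by apply/(codeBP t).2.
    by exists (cons_tuple b t); rewrite code'E.
  split; first exact: (codeBD _ _).1.
  by rewrite /composite /= -/(composite _ _) code'B (codeD _).2.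
have liftB g x y : lifts_to (composite ((B, u) :: L)) g x y ->
    lifts_to (composite L) g (B x) (B y).
  move=> [h [ch hP h0] h1]; exists (fun t => B (h t)); last by rewrite h1.
  split; last by rewrite h0.
    by apply: (square_cover_path cB) => // t /hP[].
  by move=> t /hP[hD <-]; split=> //; exact: (square_cover_disc cB).
have tails g h (s : {perm T}) : loop_off V g ->
    (forall t, lifts_to (composite L) g (code t) (code (h t))) ->
    (forall t, lifts_to (composite ((B, u) :: L)) g (code' t) (code' (s t))) ->
    forall t, behead_tuple (s t) = h (behead_tuple t).
  move=> gV hl sl t; apply: codeI.
  have := liftB _ _ _ (sl t); rewrite !code'B => l1.
  by have [] := lifts_to_inj cL' LV' gV l1 (hl (behead_tuple t)); move=> -> .
exists code'; split=> // s; rewrite [wreathZ2 _]/(wreathZ2 (size L).+1) wreathZ2S; split.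
  move=> [g gV sl].
  have [h hl] := loop_perm cL' LV' codeC gV.
  by exists h; [apply/codeW; exists g | exact: tails gV hl sl].
(* The loop [g] realising [h] avoids all of [V], so it also gives a permutation [s0] of the larger
   fibre, with the same effect on tails as [s]. The quotient [s * s0^-1] preserves tails, hence is a
   product of swaps. *)
move=> [h /codeW[g gV hl] sh].
have [s0 s0l] := loop_perm cL LV codeC' gV.
have s0h := tails _ _ _ gV hl s0l.
have -> : s = (s * s0^-1 * s0)%g by rewrite mulgKV.
apply: mono_mul; last by exists g.
apply: (@tail_preserving_gen _ (mono _ V code')).
- exact: mono1.
- exact: mono_mul.
- move=> t0; have [g' g'V [l0 l1]] := swap_loop cL uL LV V0 codeC codeBP t0.
  have [s1 s1l] := loop_perm cL LV codeC' g'V.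
  exists s1; split; first by exists g'.
    move=> t tt0; apply: codeC'.1; have [+ _] := lifts_to_inj cL LV g'V (s1l t) (l1 _ (thead t) tt0).
    exact.
  apply: codeC'.1; rewrite [RHS]code'E.
  have [+ _] := lifts_to_inj cL LV g'V (s1l (cons_tuple false t0)) l0.
  by rewrite code'E; apply.
- move=> t; rewrite permM; apply: (@perm_inj _ h).
  by rewrite -s0h permKV sh.
Qed.

(** * Blaschke products of degree two *)

Lemma cnorm_conj z : cnorm z^* = cnorm z.
Proof. by apply: complexI; rewrite -!normCE norm_conjC. Qed.

Lemma in_disc0 : in_disc 0.
Proof. by rewrite in_discE cnorm0 ltr01. Qed.

Lemma in_discN z : in_disc (- z) = in_disc z.
Proof. by rewrite !in_discE cnormN. Qed.

Lemma in_discM x y : in_disc x -> in_disc y -> in_disc (x * y).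
Proof.
rewrite !in_discE cnormM => x1 y1; have := cnorm_ge0 x; have := cnorm_ge0 y.
by move: x1 y1; nra.
Qed.

Lemma in_disc_unit g z : `|g| = 1 -> in_disc (g * z) = in_disc z.
Proof. by move=> g1; rewrite /in_disc normrM g1 mul1r. Qed.

Lemma blaschke_den a z : in_disc a -> in_disc z -> 1 - a^* * z != 0.
Proof.
move=> aD zD; rewrite subr_eq0; apply/eqP => E.
have : in_disc (a^* * z) by apply: in_discM; rewrite // in_discE cnorm_conj -in_discE.
by rewrite -E in_discE cnorm1 ltxx.
Qed.

(** The squared norm of the denominator minus that of the numerator factors as
    [(1 - |a|^2) (1 - |z|^2)]. *)
Lemma blaschke_disc a z : in_disc a -> in_disc z -> in_disc (blaschke_factor a z).
Proof.
move=> aD zD; have d0 := blaschke_den aD zD.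
rewrite /in_disc /blaschke_factor normrM normfV ltr_pdivrMr ?normr_gt0 // mul1r.
rewrite -(ltr_pXn2r (n := 2)) ?nnegrE ?normr_ge0 // -subr_gt0 !normCK.
have -> : (1 - a^* * z) * (1 - a^* * z)^* - (z - a) * (z - a)^* =
    (1 - a * a^*) * (1 - z * z^*).
  by rewrite !rmorphB !rmorphM rmorph1 /= conjCK; ring.
by rewrite -!normCK mulr_gt0 // subr_gt0 expr_lt1.
Qed.

Lemma blaschke_ccont a z : in_disc a -> in_disc z -> ccont (blaschke_factor a) z.
Proof.
move=> aD zD; apply: ccontM.
  by apply: ccontD; [exact: ccont_id | exact: ccont_cst].
apply: ccontV; last exact: blaschke_den.
apply: ccontD; first exact: ccont_cst.
by apply: ccontN; apply: ccontM; [exact: ccont_cst | exact: ccont_id].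
Qed.

Lemma blaschkeK a z : in_disc a -> in_disc z ->
  blaschke_factor (- a) (blaschke_factor a z) = z.
Proof.
move=> aD zD; have d0 := blaschke_den aD zD; have d1 := blaschke_den aD aD.
rewrite /blaschke_factor rmorphN /=.
have -> : (z - a) / (1 - a^* * z) - - a = z * (1 - a^* * a) / (1 - a^* * z) by field.
have -> : 1 - - a^* * ((z - a) / (1 - a^* * z)) = (1 - a^* * a) / (1 - a^* * z) by field.
by field; rewrite d0.
Qed.

Lemma blaschke2_normal_form B : is_blaschke 2 B -> B 0 = 0 -> exists g a,
  [/\ `|g| = 1, in_disc a & forall z, in_disc z -> B z = g * (z * blaschke_factor a z)].
Proof.
move=> [g [s [g1 sz sD BE]]] B0.
case: s sz sD BE => [|a1 [|a2 [|? ?]]] //= _ /and3P[a1D a2D _] BE.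
have g0 : g != 0 by rewrite -normr_eq0 g1 oner_eq0.
have bf0 a : blaschke_factor a 0 = - a.
  by rewrite /blaschke_factor mulr0 subr0 divr1 sub0r.
have bfz z : blaschke_factor 0 z = z.
  by rewrite /blaschke_factor conjC0 mul0r !subr0 divr1.
have := BE 0 in_disc0; rewrite B0 !big_cons big_nil mulr1 !bf0 => /esym/eqP.
rewrite mulrNN !mulf_eq0 (negPf g0) /= => /orP[]/eqP a0.
  exists g, a2; split=> // z zD.
  by rewrite BE // !big_cons big_nil mulr1 a0 bfz.
exists g, a1; split=> // z zD.
by rewrite BE // !big_cons big_nil mulr1 a0 bfz (mulrC (blaschke_factor _ _)).
Qed.

(* [c] is the hyperbolic midpoint of the zeros [0] and [a]. *)
Lemma hyperbolic_midpoint a : in_disc a -> exists c,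
  [/\ in_disc c, a + c ^+ 2 * a^* = c *+ 2, a^* + c^* ^+ 2 * a = c^* *+ 2 &
      forall z, a^* * z ^+ 2 - z *+ 2 + a = 0 -> c^* * z ^+ 2 - (1 + c * c^*) * z + c = 0].
Proof.
move=> aD; pose r := cnorm a; have r1 : r < 1 by rewrite -in_discE.
have r0 : 0 <= r := cnorm_ge0 a.
pose s := Num.sqrt (1 - r ^+ 2); have s0 : 0 <= s := sqrtr_ge0 _.
have s2 : s ^+ 2 = 1 - r ^+ 2 by rewrite sqr_sqrtr // subr_ge0 expr_le1 // ltW.
(* On the ray through [a] the midpoint equation for [c = t a] reads [1 + r^2 t^2 = 2 t]. This is its
   smaller root, in a form that is also valid for [r = 0]. *)
pose t := (1 + s)^-1.
have s1 : 1 + s != 0 by rewrite gt_eqF // ltr_wpDr.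
have t0 : 0 <= t by rewrite invr_ge0 addr_ge0.
have t1 : t <= 1 by rewrite invf_le1 ?ler_wpDr // ltr_wpDr.
have tE : 1 + t ^+ 2 * r ^+ 2 = t *+ 2.
  have -> : r ^+ 2 = 1 - s ^+ 2 by rewrite s2; ring.
  by rewrite /t; field.
have tC : 1 + t%:C ^+ 2 * (a * a^*) = t%:C *+ 2.
  rewrite -normCK normCE -/r; move/(congr1 (fun x : R => x%:C)): tE.
  by rewrite rmorphD rmorphM !rmorphXn rmorphMn.
have tJ : (t%:C)^* = t%:C by apply: conj_Creal; apply/complex_realP; exists t.
exists (t%:C * a); rewrite rmorphM /= tJ; split.
- rewrite in_discE cnormM cnorm_real ger0_norm // -/r.
  by apply: le_lt_trans r1; rewrite ler_piMl.
- transitivity (a * (1 + t%:C ^+ 2 * (a * a^*))); first by ring.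
  by rewrite tC; ring.
- transitivity (a^* * (1 + t%:C ^+ 2 * (a * a^*))); first by ring.
  by rewrite tC; ring.
(* Up to sign, the quadratic in [E] is the numerator of the derivative of [z * blaschke_factor a z].
   Scaled by [t] it becomes [(conj c z - 1) (z - c)], whose only root in the disc is [c]. *)
- move=> z E; transitivity (t%:C * (a^* * z ^+ 2 - z *+ 2 + a)); last by rewrite E mulr0.
  have -> : 1 + t%:C * a * (t%:C * a^*) = t%:C *+ 2 by rewrite -tC; ring.
  by ring.
Qed.

Lemma blaschke2_square_cover B : is_blaschke 2 B -> B 0 = 0 ->
  exists u, square_cover B u.
Proof.
move=> B2 B0; have [g [a [g1 aD BE]]] := blaschke2_normal_form B2 B0.
have [c [cD ca ca' ccrit]] := hyperbolic_midpoint aD.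
have g0 : g != 0 by rewrite -normr_eq0 g1 oner_eq0.
have gJ : g^* * g = 1 by rewrite mulrC -normCK g1 expr1n.
have gV : `|g^-1| = 1 by rewrite normfV g1 invr1.
(* This is [B c]: the midpoint equation gives [c - a = - c (1 - conj a c)]. *)
pose u := - (g * c ^+ 2).
have uD : in_disc u by rewrite in_discN in_disc_unit // expr2 in_discM.
have BD z : in_disc z -> in_disc (B z).
  by move=> zD; rewrite BE // in_disc_unit // in_discM // blaschke_disc.
have ND : in_disc (- c) by rewrite in_discN.
have den z : in_disc z -> 1 - a^* * z != 0 by exact: blaschke_den.
pose phi w := g^-1 * blaschke_factor u w.
have phiD w : in_disc w -> in_disc (phi w).
  by move=> wD; rewrite in_disc_unit // blaschke_disc.
have phiI z w : in_disc z -> in_disc w -> phi z = phi w -> z = w.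
  move=> zD wD /(mulfI (invr_neq0 g0)) E.
  by rewrite -(blaschkeK uD zD) E blaschkeK.
have phiB z : in_disc z -> phi (B z) = blaschke_factor c z * blaschke_factor c z.
  move=> zD; have dz := den z zD; have dc := blaschke_den cD zD.
  have E1 : B z - u = g * (z - c) ^+ 2 / (1 - a^* * z).
    rewrite BE // /u /blaschke_factor.
    transitivity (g * (z ^+ 2 + c ^+ 2 - z * (a + c ^+ 2 * a^*)) / (1 - a^* * z)).
      by field.
    by rewrite ca; congr (_ * _ / _); ring.
  have E2 : 1 - u^* * B z = (1 - c^* * z) ^+ 2 / (1 - a^* * z).
    rewrite BE // /u /blaschke_factor rmorphN rmorphM rmorphXn /=.
    transitivity ((1 - a^* * z + (g^* * g) * (c^* ^+ 2 * z ^+ 2 - c^* ^+ 2 * a * z)) /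
      (1 - a^* * z)); first by field.
    rewrite gJ mul1r; congr (_ / _).
    transitivity (1 + c^* ^+ 2 * z ^+ 2 - z * (a^* + c^* ^+ 2 * a)); first by ring.
    by rewrite ca'; ring.
  rewrite /phi /blaschke_factor E1 E2; field.
  by rewrite dz dc g0.
(* The deck involution: [B z = - g z (tau z)], and [tau] exchanges the two points of each fibre. The
   slope of [B] between [z] and [y] thus vanishes at [y = tau z], and a critical point is a fixed
   point of [tau]. *)
pose tau z := - blaschke_factor a z.
have tauD z : in_disc z -> in_disc (tau z).
  by move=> zD; rewrite in_discN blaschke_disc.
pose q z y := g * (y - tau z) / (1 - a^* * y).
have qE z y : in_disc z -> in_disc y -> B y - B z = q z y * (y - z).
  move=> zD yD; rewrite !BE // /q /tau /blaschke_factor.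
  by field; rewrite (den _ yD) (den _ zD).
exists u; exists (blaschke_factor c), (blaschke_factor (- c)), phi.
split; [split|split].
- by move=> z zD; split; [exact: blaschke_disc | exact: blaschke_ccont].
- by move=> z zD; split; [exact: blaschke_disc | exact: blaschke_ccont].
- move=> z zD; split; first exact: blaschkeK.
  by rewrite -{1}[c]opprK; exact: blaschkeK.
- move=> z zD; split; first exact: phiD.
  by apply: ccontM; [exact: ccont_cst | exact: blaschke_ccont].
- split=> //; first by move=> z zD; split; [exact: BD | exact: phiB].
  by split=> //; rewrite /phi /blaschke_factor subrr mul0r mulr0.
- move=> z zD; exists (q z); split.
  + apply: ccontM.
      apply: ccontM; first exact: ccont_cst.
      by apply: ccontD; [exact: ccont_id | exact: ccont_cst].
    apply: ccontV; last exact: den.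
    apply: ccontD; first exact: ccont_cst.
    by apply: ccontN; apply: ccontM; [exact: ccont_cst | exact: ccont_id].
  + by move=> y yD; exact: qE.
  move=> /eqP; rewrite !mulf_eq0 (negPf g0) invr_eq0 (negPf (den z zD)) orbF /=.
  rewrite /tau opprK => /eqP tz.
  have /ccrit E : a^* * z ^+ 2 - z *+ 2 + a = 0.
    transitivity (- ((z + blaschke_factor a z) * (1 - a^* * z))); last first.
      by rewrite tz mul0r oppr0.
    by rewrite /blaschke_factor; field; exact: den.
  have /eqP : (c^* * z - 1) * (z - c) = 0 by rewrite -{}E; ring.
  rewrite mulf_eq0 !subr_eq0 => /orP[/eqP cz|/eqP ->].
    by have := blaschke_den cD zD; rewrite cz subrr eqxx.
  have dc := den c cD.
  rewrite BE // /u /blaschke_factor; apply/eqP; rewrite -subr_eq0.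
  have -> : g * (c * ((c - a) / (1 - a^* * c))) - - (g * c ^+ 2) =
     g * c * (c *+ 2 - (a + c ^+ 2 * a^*)) / (1 - a^* * c) by field.
  by rewrite ca subrr mulr0 mul0r.
- move=> x w xD wD.
  have kD : in_disc (sqrtc (phi w)) by apply: in_disc_sqr; rewrite sqrtcK phiD.
  pose y := blaschke_factor (- c) (sqrtc (phi w)).
  have yD : in_disc y by exact: blaschke_disc.
  have By : B y = w.
    apply: phiI; rewrite ?BD // phiB //.
    by rewrite /y -{1 3}[c]opprK !blaschkeK // sqrtcK.
  have Bt : B (tau y) = w.
    rewrite -By; apply/eqP; rewrite -subr_eq0 qE ?tauD //.
    by rewrite /q subrr mulr0 !mul0r.
  (* The constant 2 bounds the denominator [|1 - conj a x|] of the slope. The product of the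
     distances from [x] to the two preimages of [w] is thereby controlled, and the nearer one
     satisfies the squared bound. *)
  have prod : cnorm (x - y) * cnorm (x - tau y) <= 2 * cnorm (B x - w).
    rewrite -By (qE y x yD xD) /q !cnormM cnormV.
    have -> : cnorm g = 1 by apply: complexI; rewrite -normCE g1.
    have dx0 : 0 < cnorm (1 - a^* * x) by rewrite cnorm_gt0 den.
    have dx2 : cnorm (1 - a^* * x) <= 2.
      have := cnormD 1 (- (a^* * x)); rewrite cnormN cnorm1 => H.
      apply: le_trans H _; rewrite -[leRHS]/(1 + 1) lerD2l ltW // -in_discE.
      by apply: in_discM; rewrite // in_discE cnorm_conj -in_discE.
    rewrite mul1r [leRHS](_ : _ =
        2 / cnorm (1 - a^* * x) * (cnorm (x - y) * cnorm (x - tau y))); last by ring.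
    rewrite ler_peMl ?mulr_ge0 ?cnorm_ge0 //.
    by rewrite ler_pdivlMr ?mul1r.
  have [le|/ltW le] := leP (cnorm (x - y)) (cnorm (x - tau y)).
    exists y; split=> //; apply: le_trans prod.
    by rewrite expr2 ler_wpM2l // cnorm_ge0.
  exists (tau y); split; rewrite ?tauD //; apply: le_trans prod.
  by rewrite expr2 ler_wpM2r // cnorm_ge0.
Qed.

(** * Critical values and the theorem *)

(** A derivative as the value of a continuous slope. Since the disc is open, agreement of [f] and
    [F] there already determines the limit. *)
Lemma cderivE (f F q : C -> C) z : in_disc z ->
  (forall y, in_disc y -> f y = F y) -> ccont q z ->
  (forall y, in_disc y -> F y - F z = q y * (y - z)) -> cderiv f z = q z.
Proof.
move=> zD fF /ccontP cq qE; rewrite /cderiv /derive1.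
apply: (@cvg_lim (C : numFieldType)^o (@norm_hausdorff _ _) _ _
  (Proper_dnbhs_numFieldType (0 : (C : numFieldType)))).
apply/(@cvgrPdist_lt _ (C : numFieldType)^o _ _
  (Proper_dnbhs_numFieldType (0 : (C : numFieldType)))) => e e0.
have eR : e = (Re e)%:C by rewrite RRe_real // gtr0_real.
have [|d d0 dP] := cq (Re e); first by rewrite -ltcR -eR.
have [d1 d10 d1P] := in_disc_open zD.
apply/(@nbhs_ballP _ (C : numFieldType)^o); exists (Num.min d d1)%:C => /=; first by rewrite ltcR lt_min d0.
move=> h; rewrite /ball /= sub0r normrN normCE ltcR lt_min => /andP[hd hd1] h0.
have hz : h + z - z = h by rewrite addrK.
have hzD : in_disc (h + z) by apply: d1P; rewrite hz.
rewrite !fF // qE // hz mulrC.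
have -> : h^-1 *: (h * q (h + z)) = q (h + z) by exact: mulKf.
by rewrite distrC eR normCE ltcR; apply: dP; rewrite hz.
Qed.

(** Chain rule for slopes: they multiply, so a zero at [x] comes from one of the factors, which then
    takes its critical value there. *)
Lemma composite_slope L x : covers L -> in_disc x -> exists q : C -> C,
  [/\ ccont q x, forall y, in_disc y -> composite L y - composite L x = q y * (y - x) &
      q x = 0 -> composite L x \in vals L].
Proof.
elim: L x => [|[B u] L IHL] x /= cL xD.
  exists (fun=> 1); split; [exact: ccont_cst | by move=> y _; rewrite mul1r |].
  by move=> /eqP; rewrite oner_eq0.
case: cL => cB cL; have BxD := square_cover_disc cB xD.
have [q [cq qE q0]] := IHL _ cL BxD.
case: (cB) => psi [psi' [phi [_ [H _]]]]; have [r [cr rE r0]] := H x xD.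
exists (fun y => q (B y) * r y); split.
- apply: ccontM => //; apply: (@ccont_comp q B) => //.
  exact: (square_cover_ccont cB).
- move=> y yD; rewrite -mulrA -rE // -qE //; exact: (square_cover_disc cB).
move=> /eqP; rewrite mulf_eq0 inE => /orP[]/eqP; last by move=> /r0 <-; rewrite eqxx.
by move=> /q0; rewrite /composite /= => ->; rewrite orbT.
Qed.

Lemma critval_vals L f w : covers L ->
  (forall y, in_disc y -> f y = composite L y) -> is_critval f w -> w \in vals L.
Proof.
move=> cL fL [z [[zD z0] <-]]; rewrite fL //.
have [q [cq qE]] := composite_slope cL zD; apply.
by rewrite -(cderivE zD fL cq qE).
Qed.

Lemma covers_of_factors (Bs : seq (C -> C)) :
  (forall j, (j < size Bs)%N -> is_blaschke 2 (nth id Bs j) /\ nth id Bs j 0 = 0) ->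
  exists L : tower, [/\ size L = size Bs, covers L &
    forall w, composite L w = foldl (fun x f => f x) w Bs].
Proof.
elim: Bs => [|B Bs IHBs] H; first by exists [::].
have [|L [sL cL LE]] := IHBs; first by move=> j jB; exact: (H j.+1).
have [B2 B0] := H 0%N isT.
have [u cB] := blaschke2_square_cover B2 B0.
by exists ((B, u) :: L); split=> //=; rewrite ?sL // => w; rewrite -LE.
Qed.

Lemma size_vals L : size (vals L) = size L.
Proof. by elim: L => //= p L ->. Qed.

Lemma clamp_id (g : R -> C) t : 0 <= t <= 1 -> g (clamp t) = g t.
Proof. by move=> t01; rewrite (clampK t01). Qed.

Section Transport.
Variables (B : C -> C) (z v : seq C) (T : finType) (F : C -> C) (code : T -> C).
Hypotheses (BF : forall w, in_disc w -> B w = F w)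
  (vP : forall w, is_critval B w <-> w \in v) (zP : fibre_enum B z) (codeC : codes F code)
  (v0 : 0 \notin v).

Lemma monodromy_permE (beta : 'I_(size z) -> T) (s : {perm 'I_(size z)}) (s' : {perm T}) :
  (forall i : 'I_(size z), nth 0 z i = code (beta i)) -> (forall t, exists i, t = beta i) ->
  (forall i, s' (beta i) = beta (s i)) ->
  monodromy_perm B z s <-> mono F v code s'.
Proof.
move=> zE betaS ss'; split.
  move=> [g [cg g0 g1 gD gl]]; exists (fun t => g (clamp t)).
    split; [exact: is_path_cont01 | | by rewrite clamp_id | by rewrite clamp_id].
    by move=> t t01; have [? gt] := gD _ (clamp01 t); split=> //; apply/negP => /vP.
  move=> t; have [i ->] := betaS t; have [h [ch hD h0 h1]] := gl i.
  exists (fun t => h (clamp t)); last by rewrite clamp_id // h1 zE ss'.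
  split; [exact: is_path_cont01 | | by rewrite clamp_id // h0 zE].
  by move=> r r01; have [? <-] := hD _ (clamp01 r); rewrite BF.
move=> [g [cg gD g0 g1] gl]; exists g; split=> //; first exact: cont01_is_path.
  by move=> t /gD[? gt]; split=> // /vP; apply/negP.
move=> i; have [h [ch hD h0] h1] := gl (beta i); exists h; split.
- exact: cont01_is_path.
- by move=> t /hD[? <-]; split; rewrite ?BF.
- by rewrite zE.
- by rewrite zE h1 ss'.
Qed.

(** Relabelling the fibre along the bijection [beta] is an injective morphism between symmetric
    groups; it maps the monodromy group onto [W]. *)
Lemma monodromy_transport (W : {set {perm T}}) :
  (forall s, mono F v code s <-> s \in W) ->
  group_set (monodromy_group B z) /\ monodromy_group B z \isog W.
Proof.
move=> WP; have [zU zF] := zP; have [codeI codeP] := codeC.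
have [beta zE] : {beta : 'I_(size z) -> T & forall i : 'I_(size z), nth 0 z i = code (beta i)}.
  apply: (boolp.choice (P := fun (i : 'I_(size z)) t => nth 0 z i = code t)) => i.
  by apply/codeP; have /zF[wD Bw] := mem_nth 0 (ltn_ord i); rewrite -BF.
have codez t : code t \in z.
  by apply/zF; have [tD Ft] := (codeP (code t)).2 (ex_intro _ t erefl); rewrite BF.
pose gamma t : 'I_(size z) := Ordinal (etrans (index_mem (code t) z) (codez t)).
have gammaK : cancel gamma beta.
  by move=> t; apply: codeI; rewrite -zE /= nth_index.
have betaK : cancel beta gamma.
  by move=> i; apply: val_inj; rewrite /= -zE index_uniq.
have finj (s : {perm 'I_(size z)}) : injective (fun t => beta (s (gamma t))).
  by move=> t t' /(can_inj betaK)/perm_inj/(can_inj gammaK).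
pose f s := perm (finj s).
have fE s i : f s (beta i) = beta (s i) by rewrite permE betaK.
have fP s : s \in monodromy_group B z <-> f s \in W.
  rewrite inE; split=> [/asboolP H|H].
    apply/WP; apply: (monodromy_permE zE _ (fE s)).1 => // t.
    by exists (gamma t); rewrite gammaK.
  apply/asboolP; apply/(monodromy_permE zE _ (fE s)); last exact/WP.
  by move=> t; exists (gamma t); rewrite gammaK.
have fM : {in [set: {perm 'I_(size z)}] &, {morph f : s t / (s * t)%g}}.
  by move=> s t _ _; apply/permP => x; rewrite -(gammaK x) permM !fE permM.
have f1 : f 1%g = 1%g by apply/permP => x; rewrite -(gammaK x) fE !perm1.
have Mgroup : group_set (monodromy_group B z).
  apply/group_setP; split; first by apply/fP; rewrite f1; apply/WP; exact: mono1.
  move=> s t /fP/WP sM /fP/WP tM; apply/fP; rewrite fM ?inE //.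
  by apply/WP; exact: mono_mul.
split=> //.
pose fm := Morphism fM.
have fI : ('injm fm)%g.
  apply/injmP => s t _ _ /= E; apply/permP => i.
  by apply: (can_inj betaK); rewrite -!fE; move: E => /= ->.
have -> : W = (fm @* monodromy_group B z)%g.
  rewrite morphimEsub ?finset.subsetT //; apply/finset.setP => s; apply/idP/imsetP.
    move=> sW.
    have sinj : injective (fun i => gamma (s (beta i))).
      by move=> i i' /(can_inj gammaK)/perm_inj/(can_inj betaK).
    have sE : s = f (perm sinj) by apply/permP => t; rewrite permE permE !gammaK.
    by exists (perm sinj) => //; apply/fP; rewrite -sE.
  by move=> [t /fP ? ->].
exact: (@sub_isog _ _ _ fm (Group Mgroup) (finset.subsetT _) fI).
Qed.

End Transport.
Unset Implicit Arguments.
Set Strict Implicit.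

Theorem theorem5p7 (n N : nat) (B : C -> C) (Bs : seq (C -> C)) :
  is_blaschke N B -> regularized B ->
  simple_critical_points B -> num_critical_values B n ->
  size Bs = n ->
  (forall j, (j < n)%N ->
     [/\ is_blaschke 2 (nth id Bs j), regularized (nth id Bs j) & nth id Bs j 0 = 0]) ->
  (forall w, in_disc w -> B w = foldl (fun x f => f x) w Bs) ->
  forall z : seq C, fibre_enum B z ->
  group_set (monodromy_group B z) /\ monodromy_group B z \isog wreathZ2 n.
Proof.
move=> _ [_ Bsimple _] _ [v [vU vn vP]] nE BsP BE z zP.
have [|L [sL cL LE]] := @covers_of_factors Bs.
  by rewrite nE => j /BsP[].
have BL w : in_disc w -> B w = composite L w by move=> wD; rewrite BE // LE.
have vL : {subset v <= vals L} by move=> w /vP; exact: critval_vals.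
(* Analysis gives only one inclusion. The equality of the two sets and the absence of repetitions in
   [vals L] both follow by counting. *)
have Lv : (size (vals L) <= size v)%N by rewrite size_vals sL nE vn.
have [_ vE] := uniq_min_size vU vL Lv.
(* A critical point over 0 would be a multiple zero of [B]. Hence the base point is not a critical
   value, and each factor has two distinct points over every point of the fibre. *)
have v0 : 0 \notin v.
  apply/negP => /vP[w [[wD w0] Bw]].
  by have := Bsimple w wD Bw; rewrite w0 eqxx.
have sub : {subset vals L <= v} by move=> w; rewrite vE.
have [code [codeC codeW]] := tower_monodromy cL (leq_size_uniq vU vL Lv) sub v0.
have := monodromy_transport BL vP zP codeC v0 codeW.
by rewrite sL nE.
Qed.
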